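(* Assume Lang's conjecture in the form: there is an absolute constant $c_L>0$ such that $\hat{h}(P)\ge c_L\max\{h(j_E),h(\Delta_E)\}$ for every elliptic curve $E/\mathbb{Q}$ and every non-torsion $P\in E(\mathbb{Q})$. Then there exist absolute constants $A>1$, $C>0$ such that for every elliptic curve $E/\mathbb{Q}$ of rank $r$, and every sequence $\{P_1,\dots,P_N\}$ of integral points (i.e. points with $x(P_i),y(P_i)\in\mathbb{Z}$ on the model $y^2=x^3+A'x+B$ described in the context) in $x$-arithmetic progression, one has $N\le C A^r$.
   Context: $j_E$, $\Delta_E$ are the $j$-invariant and minimal discriminant of $E$; $h$ is the absolute logarithmic Weil height; $\hat{h}(P)=\lim_{n\to\infty}h(x(2^nP))/4^n$ (not normalized by $1/2$). The model $y^2=x^3+A'x+B$ ($A',B\in\mathbb{Z}$) is obtained from a global minimal Weierstrass equation $y^2+a_1xy+a_3y=x^3+a_2x^2+a_4x+a_6$ of $E$ by the substitution $x\mapsto \frac{1}{36}(x-3b_2)$, $y\mapsto \frac12(\frac{y}{108}-\frac{a_1}{36}(x-3b_2)-a_3)$. A sequence $\{P_1,\dots,P_N\}\subseteq E(\mathbb{Q})$ is in $x$-arithmetic progression if $x(P_1),\dots,x(P_N)$ are $N$ distinct rationals forming an arithmetic progression. *)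

(* Defs.v *)
From HB Require Import structures.
From mathcomp Require Import all_boot all_order all_algebra.
From mathcomp Require Import all_classical all_reals all_analysis.
From mathcomp Require Import Rstruct Rstruct_topology.
From Stdlib Require Import Rdefinitions.

Set Implicit Arguments.
Unset Strict Implicit.
Unset Printing Implicit Defensive.
Import Order.TTheory GRing.Theory Num.Theory.
Local Open Scope ring_scope.

(* A Weierstrass equation y^2 + a1 xy + a3 y = x^3 + a2 x^2 + a4 x + a6 over Q *)
Record wcoef := WCoef { a1 : rat; a2 : rat; a3 : rat; a4 : rat; a6 : rat }.

Definition b2 (E : wcoef) : rat := a1 E ^+ 2 + 4 * a2 E.
Definition b4 (E : wcoef) : rat := 2 * a4 E + a1 E * a3 E.
Definition b6 (E : wcoef) : rat := a3 E ^+ 2 + 4 * a6 E.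
Definition b8 (E : wcoef) : rat :=
  a1 E ^+ 2 * a6 E + 4 * a2 E * a6 E - a1 E * a3 E * a4 E
  + a2 E * a3 E ^+ 2 - a4 E ^+ 2.
Definition c4 (E : wcoef) : rat := b2 E ^+ 2 - 24 * b4 E.
Definition disc (E : wcoef) : rat :=
  - b2 E ^+ 2 * b8 E - 8 * b4 E ^+ 3 - 27 * b6 E ^+ 2 + 9 * b2 E * b4 E * b6 E.
Definition jinv (E : wcoef) : rat := c4 E ^+ 3 / disc E.

(* Points: None is the point at infinity O, Some (x, y) an affine point. *)
Definition point := option (rat * rat).

Definition on_curve (E : wcoef) (P : point) : bool :=
  match P with
  | None => true
  | Some (x, y) =>
      y ^+ 2 + a1 E * x * y + a3 E * y
        == x ^+ 3 + a2 E * x ^+ 2 + a4 E * x + a6 E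
  end.

Definition pneg (E : wcoef) (P : point) : point :=
  match P with
  | None => None
  | Some (x, y) => Some (x, - y - a1 E * x - a3 E)
  end.

Definition padd (E : wcoef) (P Q : point) : point :=
  match P, Q with
  | None, _ => Q
  | _, None => P
  | Some (x1, y1), Some (x2, y2) =>
      if (x1 == x2) && (y1 + y2 + a1 E * x2 + a3 E == 0) then None
      else
        let lam := if x1 != x2 then (y2 - y1) / (x2 - x1)
                   else (3 * x1 ^+ 2 + 2 * a2 E * x1 + a4 E - a1 E * y1)
                          / (2 * y1 + a1 E * x1 + a3 E) in
        let nu := if x1 != x2 then (y1 * x2 - y2 * x1) / (x2 - x1)
                  else (- x1 ^+ 3 + a4 E * x1 + 2 * a6 E - a3 E * y1)
                         / (2 * y1 + a1 E * x1 + a3 E) in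
        let x3 := lam ^+ 2 + a1 E * lam - a2 E - x1 - x2 in
        Some (x3, - (lam + a1 E) * x3 - nu - a3 E)
  end.

Definition pnmul (E : wcoef) (n : nat) (P : point) : point :=
  iter n (padd E P) None.

Definition pzmul (E : wcoef) (k : int) (P : point) : point :=
  match k with
  | Posz n => pnmul E n P
  | Negz n => pneg E (pnmul E n.+1 P)
  end.

Definition lincomb (E : wcoef) (Ps : seq point) (ns : seq int) : point :=
  foldr (fun pn acc => padd E (pzmul E pn.2 pn.1) acc) None (zip Ps ns).

Definition independent (E : wcoef) (Ps : seq point) : Prop :=
  forall ns : seq int, size ns = size Ps ->
    lincomb E Ps ns = None -> all (fun n => n == 0) ns.

Definition rank_is (E : wcoef) (r : nat) : Prop :=
  (exists Ps : seq point, [/\ size Ps = r, all (on_curve E) Ps & independent E Ps])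
  /\ (forall Ps : seq point, size Ps = r.+1 -> all (on_curve E) Ps ->
        ~ independent E Ps).

Definition non_torsion (E : wcoef) (P : point) : Prop :=
  forall n : nat, leq 1 n -> pnmul E n P <> None.

Definition hgt (q : rat) : R :=
  ln (Num.max (`|numq q|%:~R : R) (`|denq q|%:~R : R)).

Definition hx (P : point) : R :=
  match P with None => 0 | Some (x, _) => hgt x end.

(* Canonical height (not normalized by 1/2): lim h(x(2^n P)) / 4^n. *)
Definition hhat (E : wcoef) (P : point) : R :=
  limn (fun n : nat => hx (iter n (fun Q => padd E Q Q) P) / 4 ^+ n).

(* Change of variables x = u^2 x' + r, y = u^3 y' + s u^2 x' + t. *)
Definition change (E : wcoef) (u r s t : rat) : wcoef :=
  WCoef ((a1 E + 2 * s) / u)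
        ((a2 E - s * a1 E + 3 * r - s ^+ 2) / u ^+ 2)
        ((a3 E + r * a1 E + 2 * t) / u ^+ 3)
        ((a4 E - s * a3 E + 2 * r * a2 E - (t + r * s) * a1 E
          + 3 * r ^+ 2 - 2 * s * t) / u ^+ 4)
        ((a6 E + r * a4 E + r ^+ 2 * a2 E + r ^+ 3 - t * a3 E - t ^+ 2
          - r * t * a1 E) / u ^+ 6).

Definition integral_model (E : wcoef) : bool :=
  all (fun a : rat => a \is a Num.int) [:: a1 E; a2 E; a3 E; a4 E; a6 E].

Definition global_minimal (E : wcoef) : Prop :=
  [/\ integral_model E, disc E != 0 &
      forall u r s t : rat, u != 0 -> integral_model (change E u r s t) ->
        `|disc E| <= `|disc (change E u r s t)|].

Definition Lang_conjecture (cL : R) : Prop :=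
  forall E : wcoef, global_minimal E ->
  forall P : point, on_curve E P -> non_torsion E P ->
    cL * Num.max (hgt (jinv E)) (hgt (disc E)) <= hhat E P.

(* Coordinates (X, Y) of a point (x, y) of the minimal equation on the model
   y^2 = x^3 + A'x + B, i.e. the inverse of the substitution
   x = (X - 3 b2)/36, y = (Y/108 - a1 (X - 3 b2)/36 - a3)/2. *)
Definition sX (E : wcoef) (p : rat * rat) : rat := 36 * p.1 + 3 * b2 E.
Definition sY (E : wcoef) (p : rat * rat) : rat :=
  108 * (2 * p.2 + a1 E * p.1 + a3 E).

(* Main.v *)
Require Import Defs.
From Stdlib Require Import Rdefinitions.
From mathcomp Require Import Rstruct Rstruct_topology.
From HB Require Import structures.
From mathcomp Require Import all_boot all_order all_algebra.
From mathcomp Require Import all_classical all_reals all_analysis.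
From mathcomp Require Import zify ring lra.

(** The points of the short model form a group carrying the canonical height,
    a positive semidefinite quadratic form which, because the rank is [r], is a
    sum of squares of [r] additive functions.  Rounding these functions shows
    that a set of points of bounded height whose differences have height bounded
    below has at most [K ^ r] elements.

    Let [H = max (h j) (h Delta)] and let [L] be the logarithm of the largest
    [|x|] in the progression.  If [L] is large compared with [H], the quarter of
    the progression next to its larger end consists of points of height about
    [L] whose pairwise sums have height at most [3 L + O(H)], so that by the
    parallelogram law their differences have height at least [L - O(H)].

    Otherwise all heights are [O(H)], and Lang's conjecture separates the classes
    modulo torsion.  Torsion points have 2-integral [x], so two points of one
    class with [x1 = x2] modulo [2 ^ e] satisfy [y1 + y2 = 0] modulo [2 ^ e].
    Read the indices of a class in base 16.  If at some node of this tree children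
    in all four residue classes modulo 4 contained three or more points, divided
    differences of [x ^ 3 + A x + B] would make [A] divisible by [2 ^ 8] and [B] by
    [2 ^ 12], against minimality at 2.  Hence a class has at most [4 * 14 ^ n]
    points if [N <= 16 ^ n], a power saving over [N].  Working with divisibility
    by 2 replaces any uniform bound for the torsion subgroup. *)

Set Implicit Arguments.
Unset Strict Implicit.
Unset Printing Implicit Defensive.
Import Order.TTheory GRing.Theory Num.Theory.
Import numFieldNormedType.Exports.
Local Open Scope ring_scope.


(** * The group law of a short Weierstrass equation *)

(** Packing in [r] dimensions separates points only up to height zero, so the real obstacle is a
    single class modulo torsion. There the congruence concerns [y1 + y2] and not one [y]; three
    points of a child isolate one [y] at the cost of one power of 2. Base 16 makes the members of a
    child agree to four more powers of 2 than the steps at their node, and the three powers that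
    survive are what the divided differences consume. The power saving pays for itself: with [W]
    classes and [16 ^ (n - 1) < N <= 16 ^ n], the bound [N <= 4 W 14 ^ n] makes [(16 / 14) ^ n] at
    most a constant times [W], hence [N] at most a constant times [W ^ 24], still exponential in the
    rank. All errors in comparing heights are [O(1 + ln m)], where [m] bounds [|A|] and [|B|]. They
    are multiples of [H] because [c4 ^ 3 = j Delta] and [c6 ^ 2 = c4 ^ 3 - 1728 Delta] control [m],
    while [H >= ln 2] absorbs absolute constants. Lang's constant enters only through the packing
    radius of the second case, hence only through the base of the exponential. *)

Section ShortCurve.
Variable F : realFieldType.

(* This covers chords and tangents at once: on a common curve either equation
   implies the other one when [x1 != x2] and [y1 + y2 != 0], only the second one
   determines the slope of a tangent, and no [l] solves both for two opposite
   points. *)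
Definition is_slope (A x1 y1 x2 y2 l : F) : Prop :=
  y2 - y1 = l * (x2 - x1) /\ l * (y1 + y2) = x1 ^+ 2 + x1 * x2 + x2 ^+ 2 + A.

Lemma is_slope_sym A x1 y1 x2 y2 l :
  is_slope A x1 y1 x2 y2 l -> is_slope A x2 y2 x1 y1 l.
Proof. by move=> [h1 h2]; split; lra. Qed.

(** For [(P + Q) + R] the slope is [-(l + k)]. Exchanging [P] and [R] exchanges [l] and [m] and
    fixes [k], so [P + (Q + R)] has slope [-(m + k)], and the two third points agree. *)
Lemma is_slope_assoc A x1 y1 x2 y2 x3 y3 l m :
    is_slope A x1 y1 x2 y2 l -> is_slope A x2 y2 x3 y3 m -> l != m ->
  let k := (x3 - x1) / (l - m) in
  let X := l ^+ 2 - x1 - x2 in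
  is_slope A X (- (y1 + l * (X - x1))) x3 y3 (- (l + k)).
Proof.
move=> [h1 h2] [h3 h4]; rewrite -subr_eq0 => lm /=.
have e1 : y1 = y2 - l * (x2 - x1) by lra.
have e3 : y3 = y2 + m * (x3 - x2) by lra.
subst y1 y3.
have eA : A = l * (y2 - l * (x2 - x1) + y2) - (x1 ^+ 2 + x1 * x2 + x2 ^+ 2) by lra.
subst A.
(* With [y1], [y3] and [A] eliminated, what remains is linear in [y2] with coefficient
   [2 (l - m)]. *)
have ey : y2 = ((x1 - x3) * (x1 + x2 + x3) - l ^+ 2 * (x1 - x2)
                + m ^+ 2 * (x3 - x2)) / (2 * (l - m)).
  apply: (@mulIf _ (2 * (l - m))); first by rewrite mulf_neq0 ?pnatr_eq0.
  rewrite mulfVK ?mulf_neq0 ?pnatr_eq0 //; nra.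
by subst y2; split; field; rewrite lm ?pnatr_eq0.
Qed.

(** Reflected in the x-axis, the line through [P] and [Q] has slope [-m] and carries [-P], [-Q] and
    [P + Q]; it therefore computes [-P + (P + Q)]. *)
Lemma is_slope_cancel A x2 y2 x3 y3 m :
    is_slope A x2 y2 x3 y3 m ->
  let X := m ^+ 2 - x2 - x3 in
  is_slope A x2 (- y2) X (- (y2 + m * (X - x2))) (- m).
Proof.
move=> [h1 h2] /=; split; first by ring.
have e3 : y3 = y2 + m * (x3 - x2) by lra.
by subst y3; have -> : A = m * (y2 + (y2 + m * (x3 - x2))) - (x2 ^+ 2 + x2 * x3 + x3 ^+ 2);
  [lra|ring].
Qed.

Lemma is_slope_on A B x1 y1 x2 y2 l :
    is_slope A x1 y1 x2 y2 l -> y1 ^+ 2 = x1 ^+ 3 + A * x1 + B ->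
  let X := l ^+ 2 - x1 - x2 in
  (- (y1 + l * (X - x1))) ^+ 2 = X ^+ 3 + A * X + B.
Proof.
move=> [h1 h2] h /=.
have e2 : y2 = y1 + l * (x2 - x1) by lra.
subst y2.
have -> : B = y1 ^+ 2 - x1 ^+ 3 - A * x1 by lra.
have -> : A = l * (y1 + (y1 + l * (x2 - x1))) - (x1 ^+ 2 + x1 * x2 + x2 ^+ 2) by lra.
by ring.
Qed.

(** Two lines through the same point with the same slope coincide, so the third point is either the
    first one or the remaining intersection with the cubic. *)
Lemma is_slope_eq A B x1 y1 x2 y2 x3 y3 l :
    is_slope A x1 y1 x2 y2 l -> is_slope A x2 y2 x3 y3 l ->
    y1 ^+ 2 = x1 ^+ 3 + A * x1 + B -> y3 ^+ 2 = x3 ^+ 3 + A * x3 + B ->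
  (x1 = x3 /\ y1 = y3) \/
  (x3 = l ^+ 2 - x1 - x2 /\ y3 = y1 + l * (x3 - x1)).
Proof.
move=> [h1 h2] [h3 h4] h5 h6.
have e1 : y1 = y2 - l * (x2 - x1) by lra.
have e3 : y3 = y2 + l * (x3 - x2) by lra.
have [e|ne] := eqVneq x1 x3; first by left; split => //; subst x3; lra.
have: (x3 - x1) * (x3 + x1 + x2 - l ^+ 2) = 0.
  by subst y1 y3; lra.
move/eqP; rewrite mulf_eq0 subr_eq0 eq_sym (negPf ne) /= => /eqP e.
by right; split; subst y1 y3; lra.
Qed.

Record curve := Curve {
  cA : F; cB : F; curve_nonsing : 4 * cA ^+ 3 + 27 * cB ^+ 2 != 0 }.

Definition on_short (C : curve) (P : option (F * F)) : bool :=
  if P is Some (x, y) then y ^+ 2 == x ^+ 3 + cA C * x + cB C else true.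

Record curve_point (C : curve) := CurvePoint { cval :> option (F * F); _ : on_short C cval }.
HB.instance Definition _ (C : curve) := [isSub for @cval C].
HB.instance Definition _ (C : curve) := [Choice of curve_point C by <:].

Definition slope (A x1 y1 x2 y2 : F) : F :=
  if x1 == x2 then (3 * x1 ^+ 2 + A) / (2 * y1) else (y2 - y1) / (x2 - x1).

Definition sadd (A : F) (P Q : option (F * F)) : option (F * F) :=
  match P, Q with
  | None, _ => Q
  | _, None => P
  | Some (x1, y1), Some (x2, y2) =>
      if (x1 == x2) && (y1 == - y2) then None
      else let l := slope A x1 y1 x2 y2 in
           let x3 := l ^+ 2 - x1 - x2 in
           Some (x3, - (y1 + l * (x3 - x1)))
  end.

Definition sneg (P : option (F * F)) : option (F * F) :=
  if P is Some (x, y) then Some (x, - y) else None.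

Variable C : curve.
Let A := cA C.
Let B := cB C.

Lemma curve_smooth x y : y ^+ 2 = x ^+ 3 + A * x + B ->
  ~ (y = 0 /\ 3 * x ^+ 2 + A = 0).
Proof.
move=> e [y0 d0]; have /eqP := curve_nonsing C; apply.
rewrite -/A -/B; have eA : A = - (3 * x ^+ 2) by lra.
by have -> : B = 2 * x ^+ 3; [subst y; rewrite eA in e; lra|rewrite eA; ring].
Qed.

Lemma slopeP x1 y1 x2 y2 :
    y1 ^+ 2 = x1 ^+ 3 + A * x1 + B -> y2 ^+ 2 = x2 ^+ 3 + A * x2 + B ->
    ~~ ((x1 == x2) && (y1 == - y2)) ->
  is_slope A x1 y1 x2 y2 (slope A x1 y1 x2 y2).
Proof.
move=> e1 e2; rewrite /slope; case: eqVneq => [ex|nx] /= h.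
  subst x2.
  have : (y1 - y2) * (y1 + y2) = 0 by lra.
  move/eqP; rewrite mulf_eq0 subr_eq0 addr_eq0 (negPf h) orbF => /eqP ey.
  subst y2; have y0 : y1 != 0.
    by apply: contraNneq h => ->; rewrite oppr0.
  by split; [lra|field; rewrite y0].
have dx : x2 - x1 != 0 by rewrite subr_eq0 eq_sym.
split; first by rewrite divfK.
apply: (mulfI dx).
have -> : (x2 - x1) * ((y2 - y1) / (x2 - x1) * (y1 + y2)) = y2 ^+ 2 - y1 ^+ 2.
  by field.
by rewrite e1 e2; ring.
Qed.

(** For opposite points the two slope equations collapse to [y = 0] and [3 x ^ 2 + A = 0], that is,
    to a singular point. *)
Lemma slope_neq x1 y1 x2 y2 l :
  y1 ^+ 2 = x1 ^+ 3 + A * x1 + B -> is_slope A x1 y1 x2 y2 l ->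
  ~~ ((x1 == x2) && (y1 == - y2)).
Proof.
move=> e1 [h1 h2]; apply/negP => /andP[/eqP ex /eqP ey]; subst x2 y1.
apply: (@curve_smooth x1 (- y2)) => //.
have y0 : y2 = 0 by lra.
by subst y2; split; lra.
Qed.

Lemma is_slope_uniq x1 y1 x2 y2 l m :
  y1 ^+ 2 = x1 ^+ 3 + A * x1 + B ->
  is_slope A x1 y1 x2 y2 l -> is_slope A x1 y1 x2 y2 m -> l = m.
Proof.
move=> e1 h; move: (slope_neq e1 h); move: h => [h1 h2] ne [h3 h4].
apply/eqP; case: (eqVneq x1 x2) ne => /= [ex ne|nx _]; last first.
  have dx : x2 - x1 != 0 by rewrite subr_eq0 eq_sym.
  by apply/eqP; apply: (mulIf dx); rewrite -h1 -h3.
by apply/eqP; apply: (mulIf (x := y1 + y2)); rewrite ?addr_eq0 // h2 h4.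
Qed.

Lemma saddE x1 y1 x2 y2 l :
    y1 ^+ 2 = x1 ^+ 3 + A * x1 + B -> y2 ^+ 2 = x2 ^+ 3 + A * x2 + B ->
    is_slope A x1 y1 x2 y2 l ->
  sadd A (Some (x1, y1)) (Some (x2, y2)) =
    Some (l ^+ 2 - x1 - x2, - (y1 + l * (l ^+ 2 - x1 - x2 - x1))).
Proof.
move=> e1 e2 h; have ne := slope_neq e1 h.
by rewrite /= (negPf ne) (is_slope_uniq e1 h (slopeP e1 e2 ne)).
Qed.

Lemma sadd0 P : sadd A P None = P.
Proof. by case: P => [[]|]. Qed.

Lemma sadd_on P Q : on_short C P -> on_short C Q -> on_short C (sadd A P Q).
Proof.
case: P Q => [[x1 y1]|] [[x2 y2]|] //= /eqP e1 /eqP e2.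
case: ifP => // /negbT ne /=; apply/eqP.
exact: (is_slope_on (slopeP e1 e2 ne) e1).
Qed.

Lemma sneg_on P : on_short C P -> on_short C (sneg P).
Proof. by case: P => [[x y]|] //=; rewrite sqrrN. Qed.

Lemma saddC P Q : on_short C P -> on_short C Q -> sadd A P Q = sadd A Q P.
Proof.
case: P Q => [[x1 y1]|] [[x2 y2]|] // /eqP e1 /eqP e2.
have [/andP[/eqP ex /eqP ey]|ne] := boolP ((x1 == x2) && (y1 == - y2)).
  by subst x2 y1; rewrite /= !eqxx opprK eqxx.
have h := slopeP e1 e2 ne; rewrite (saddE e1 e2 h) (saddE e2 e1 (is_slope_sym h)).
by case: h => h1 h2; congr (Some (_, _)); lra.
Qed.

Lemma saddN P : sadd A (sneg P) P = None.
Proof. by case: P => [[x y]|] //=; rewrite !eqxx. Qed.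

Lemma sadd_cancel P Q : on_short C P -> on_short C Q ->
  sadd A (sneg P) (sadd A P Q) = Q.
Proof.
case: P Q => [[x1 y1]|] [[x2 y2]|] //; [|by move=> *; rewrite [sadd _ _ None]/= saddN].
move=> hP hQ; have /eqP e1 := hP; have /eqP e2 := hQ.
have [/andP[/eqP ex /eqP ey]|ne] := boolP ((x1 == x2) && (y1 == - y2)).
  by subst x2 y1; rewrite /= eqxx /= eqxx /= opprK.
have h := slopeP e1 e2 ne; have := sadd_on hP hQ.
rewrite (saddE e1 e2 h); set l := slope _ _ _ _ _ in h * => /eqP e3.
rewrite [sneg _]/= (saddE _ e3 (is_slope_cancel h)); last by rewrite sqrrN.
by case: h => h1 h2; congr (Some (_, _)); lra.
Qed.

Lemma sadd_neg_cancel P Q : on_short C P -> on_short C Q ->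
  sadd A P (sadd A (sneg P) Q) = Q.
Proof.
move=> hP hQ; have := sadd_cancel (sneg_on hP) hQ.
by case: P hP => [[x y]|] //=; rewrite opprK.
Qed.

Lemma saddA P Q R : on_short C P -> on_short C Q -> on_short C R ->
  sadd A P (sadd A Q R) = sadd A (sadd A P Q) R.
Proof.
move=> hP hQ hR.
case eP : P (hP) => [[x1 y1]|] // /eqP e1.
case eQ : Q (hQ) => [[x2 y2]|] // /eqP e2.
case eR : R (hR) => [[x3 y3]|] // => [/eqP e3|_]; last first.
  by rewrite !sadd0.
have [/andP[/eqP ex /eqP ey]|ne12] := boolP ((x1 == x2) && (y1 == - y2)).
  subst x2 y1; rewrite -[Some (x1, - y2)]/(sneg (Some (x1, y2))) saddN.
  by rewrite sadd_cancel // -?eQ -?eR.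
have [/andP[/eqP ex /eqP ey]|ne23] := boolP ((x2 == x3) && (y2 == - y3)).
  subst x3 y2; rewrite -[Some (x2, - y3)]/(sneg (Some (x2, y3))).
  rewrite saddN sadd0 -eP -eR saddC ?sadd_on ?sneg_on //.
  by rewrite (saddC hP (sneg_on hR)) sadd_neg_cancel.
have h12 := slopeP e1 e2 ne12; have h23 := slopeP e2 e3 ne23.
move: h12 h23; set l := slope _ x1 _ _ _; set m := slope _ _ _ x3 _ => h12 h23.
have := sadd_on hP hQ; have := sadd_on hQ hR.
rewrite eP eQ eR (saddE e1 e2 h12) (saddE e2 e3 h23) => /eqP e23 /eqP e12.
(* Equal slopes put [P], [Q], [R] on one line: either [R = P], where commutativity suffices, or
   [R = -(P + Q)], where both sides are the point at infinity. *)
have [elm|nlm] := eqVneq l m.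
  rewrite -elm in h23 e23 *.
  have [[ex ey]|[ex ey]] := is_slope_eq h12 h23 e1 e3.
    subst x3 y3; rewrite -(saddE e2 e1 h23) -(saddE e1 e2 h12) -eP -eQ.
    by rewrite (saddC hQ hP) [RHS]saddC ?sadd_on.
  rewrite [sadd A (Some (_ - _, _)) _]/= -ex eqxx ey eqxx /=.
  have -> : l ^+ 2 - x2 - x3 = x1 by lra.
  case: h12 h23 => h1 h2 [h3 h4].
  rewrite eqxx /=; case: eqP => // ne; exfalso; apply: ne; lra.
have h1 := is_slope_assoc h12 h23 nlm.
have nml : m != l by rewrite eq_sym.
have h2 := is_slope_assoc (is_slope_sym h23) (is_slope_sym h12) nml.
rewrite /= in h1 h2.
have ey : - (y3 + m * (m ^+ 2 - x3 - x2 - x3)) = - (y2 + m * (m ^+ 2 - x2 - x3 - x2)).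
  by case: h23 => *; lra.
have ex : m ^+ 2 - x3 - x2 = m ^+ 2 - x2 - x3 by ring.
rewrite ey ex in h2.
rewrite (saddE e12 e3 h1) saddC -?eP //; last exact/eqP.
rewrite eP (saddE e23 e1 h2).
have dlm : l - m != 0 by rewrite subr_eq0.
have dml : m - l != 0 by rewrite subr_eq0 eq_sym.
case: h12 h23 => h3 h4 [h5 h6].
have ey1 : y1 = y2 - l * (x2 - x1) by lra.
rewrite ey1; congr (Some (_, _)); field; rewrite ?dlm ?dml //.
Qed.

Fact on_short_None : on_short C None. Proof. by []. Qed.
Definition cpt0 : curve_point C := CurvePoint on_short_None.
Fact cptN_subproof (P : curve_point C) : on_short C (sneg P).
Proof. by case: P => P hP; exact: sneg_on. Qed.
Definition cptN (P : curve_point C) : curve_point C := CurvePoint (cptN_subproof P).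
Fact cptD_subproof (P Q : curve_point C) : on_short C (sadd A P Q).
Proof. by case: P Q => P hP [Q hQ]; exact: sadd_on. Qed.
Definition cptD (P Q : curve_point C) : curve_point C := CurvePoint (cptD_subproof P Q).

Lemma cptDA : associative cptD.
Proof. by move=> [P hP] [Q hQ] [R hR]; apply/val_inj/saddA. Qed.
Lemma cptDC : commutative cptD.
Proof. by move=> [P hP] [Q hQ]; apply/val_inj/saddC. Qed.
Lemma cpt0D : left_id cpt0 cptD.
Proof. by move=> [P hP]; exact/val_inj. Qed.
Lemma cptND : left_inverse cpt0 cptN cptD.
Proof. by move=> [P hP]; exact/val_inj/saddN. Qed.

HB.instance Definition _ := GRing.isZmodule.Build (curve_point C) cptDA cptDC cpt0D cptND.

Lemma cvalD (P Q : curve_point C) : cval (P + Q) = sadd A P Q. Proof. by []. Qed.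
Lemma cvalN (P : curve_point C) : cval (- P) = sneg P. Proof. by []. Qed.

End ShortCurve.

(** * From the minimal equation to the short one *)

Definition c6 (E : wcoef) : rat := - b2 E ^+ 3 + 36 * b2 E * b4 E - 216 * b6 E.

Lemma c4_c6_disc E : c4 E ^+ 3 - c6 E ^+ 2 = 1728 * disc E.
Proof. by rewrite /c4 /c6 /disc /b2 /b4 /b6 /b8; ring. Qed.

Lemma short_nonsing E : disc E != 0 ->
  4 * (- 27 * c4 E) ^+ 3 + 27 * (- 54 * c6 E) ^+ 2 != 0.
Proof.
move=> d0; have -> : 4 * (- 27 * c4 E) ^+ 3 + 27 * (- 54 * c6 E) ^+ 2 =
  - (108 ^+ 4) * disc E.
  have -> : disc E = (c4 E ^+ 3 - c6 E ^+ 2) / 1728.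
    by rewrite c4_c6_disc mulrC mulKf ?pnatr_eq0.
  by field.
by apply: mulf_neq0 d0; rewrite oppr_eq0; apply: expf_neq0; rewrite pnatr_eq0.
Qed.

Definition short_curve E (d0 : disc E != 0) : curve rat := Curve (short_nonsing d0).

Definition to_short (E : wcoef) (P : Defs.point) : option (rat * rat) :=
  if P is Some p then Some (sX E p, sY E p) else None.

(* The slopes [3 (2 lam + a1)] on the short model and [lam] on the general one
   correspond under [X = 36 x + 3 b2], [Y = 108 (2 y + a1 x + a3)]. *)
Lemma tangent_to_short (F : realFieldType) (a1 a2 a3 a4 a6 x y y' : F) :
    y ^+ 2 + a1 * x * y + a3 * y = x ^+ 3 + a2 * x ^+ 2 + a4 * x + a6 ->
    y' ^+ 2 + a1 * x * y' + a3 * y' = x ^+ 3 + a2 * x ^+ 2 + a4 * x + a6 ->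
    y + y' + a1 * x + a3 != 0 ->
  let b2 := a1 ^+ 2 + 4 * a2 in
  let lam := (3 * x ^+ 2 + 2 * a2 * x + a4 - a1 * y) / (2 * y + a1 * x + a3) in
  let nu := (- x ^+ 3 + a4 * x + 2 * a6 - a3 * y) / (2 * y + a1 * x + a3) in
  [/\ (3 * (36 * x + 3 * b2) ^+ 2 + - 27 * (b2 ^+ 2 - 24 * (2 * a4 + a1 * a3)))
        / (2 * (108 * (2 * y + a1 * x + a3))) = 3 * (2 * lam + a1),
      nu = y - lam * x & y' = y].
Proof.
move=> e1 e2 ne /=.
have : (y - y') * (y + y' + a1 * x + a3) = 0 by lra.
move/eqP; rewrite mulf_eq0 subr_eq0 (negPf ne) orbF => /eqP ey; subst y'.
have eta : 2 * y + a1 * x + a3 != 0.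
  by move: ne; have -> : y + y = 2 * y by ring.
split=> //; first by field; rewrite eta.
apply: (mulIf eta); rewrite divfK //.
set M := 3 * x ^+ 2 + _ + _ - _.
have -> : (y - M / (2 * y + a1 * x + a3) * x) * (2 * y + a1 * x + a3) =
  y * (2 * y + a1 * x + a3) - M * x by field; rewrite eta.
by rewrite /M; lra.
Qed.

Lemma chord_to_short (F : realFieldType) (a1 a3 b2 x1 y1 x2 y2 : F) : x1 != x2 ->
  let lam := (y2 - y1) / (x2 - x1) in
  (108 * (2 * y2 + a1 * x2 + a3) - 108 * (2 * y1 + a1 * x1 + a3))
    / (36 * x2 + 3 * b2 - (36 * x1 + 3 * b2)) = 3 * (2 * lam + a1) /\
  (y1 * x2 - y2 * x1) / (x2 - x1) = y1 - lam * x1.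
Proof.
move=> nx /=; have dx : x2 - x1 != 0 by rewrite subr_eq0 eq_sym.
split; last by field; rewrite dx.
have -> : 36 * x2 + 3 * b2 - (36 * x1 + 3 * b2) = 36 * (x2 - x1) by ring.
by field; rewrite dx.
Qed.

Lemma short_coord_inj (F : realFieldType) (a1 a3 b2 x y x' y' : F) :
  36 * x + 3 * b2 = 36 * x' + 3 * b2 ->
  108 * (2 * y + a1 * x + a3) = 108 * (2 * y' + a1 * x' + a3) ->
  x = x' /\ y = y'.
Proof.
move=> hX hY; have ex : x = x' by lra.
by subst x'; split=> //; lra.
Qed.

Section Transfer.
Variables (E : wcoef) (d0 : disc E != 0).
Let C := short_curve d0.

Lemma to_short_on P : on_short C (to_short E P) = on_curve E P.
Proof.
case: P => [[x y]|] //=; rewrite /sX /sY /=.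
rewrite -subr_eq0 -[RHS]subr_eq0.
set u := (X in (X == 0) = _); set v := (X in _ = (X == 0)).
have -> : u = 216 ^+ 2 * v by rewrite /u /v /c4 /c6 /b2 /b4 /b6; ring.
by rewrite mulf_eq0 expf_eq0 pnatr_eq0.
Qed.

Lemma to_short_neg P : to_short E (pneg E P) = sneg (to_short E P).
Proof. by case: P => [[x y]|] //=; congr (Some (_, _)); rewrite /sY /=; ring. Qed.

Lemma to_short_add P Q : on_curve E P -> on_curve E Q ->
  to_short E (padd E P Q) = sadd (cA C) (to_short E P) (to_short E Q).
Proof.
case: P Q => [[x1 y1]|] [[x2 y2]|] // /eqP e1 /eqP e2.
cbv beta iota delta [padd sadd to_short].
have eX : (sX E (x1, y1) == sX E (x2, y2)) = (x1 == x2).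
  rewrite /sX /= (inj_eq (addIr _)); apply: inj_eq; apply: mulfI.
  by rewrite pnatr_eq0.
have eY : x1 = x2 -> (sY E (x1, y1) == - sY E (x2, y2)) =
    (y1 + y2 + a1 E * x2 + a3 E == 0).
  move=> ->; rewrite -addr_eq0 /sY /= -mulrDr mulf_eq0 pnatr_eq0 /=.
  have -> : 2 * y1 + a1 E * x2 + a3 E + (2 * y2 + a1 E * x2 + a3 E) =
    2 * (y1 + y2 + a1 E * x2 + a3 E) by ring.
  by rewrite mulf_eq0 pnatr_eq0.
have -> : (sX E (x1, y1) == sX E (x2, y2)) && (sY E (x1, y1) == - sY E (x2, y2)) =
    (x1 == x2) && (y1 + y2 + a1 E * x2 + a3 E == 0).
  by rewrite eX; case: (x1 =P x2) => //= /eY.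
case: ifP => [//|/negbT ne]; cbv zeta.
set lam := if x1 != x2 then _ else _; set nu := if x1 != x2 then _ else _.
have [elam enu] : slope (cA C) (sX E (x1, y1)) (sY E (x1, y1)) (sX E (x2, y2))
    (sY E (x2, y2)) = 3 * (2 * lam + a1 E) /\ nu = y1 - lam * x1.
  rewrite /slope eX {}/lam {}/nu.
  cbv beta iota delta [sX sY fst snd C short_curve cA c4 b2 b4]; case: eqVneq ne => [ex|nx];
    cbv beta iota delta [negb andb] => ne.
    subst x2; have [h1 h2 _] := tangent_to_short e1 e2 ne.
    by split; [exact: h1|exact: h2].
  exact: chord_to_short nx.
rewrite elam enu /sX /sY /= /b2; congr (Some (_, _)); ring.
Qed.

Lemma to_short_inj : injective (to_short E).
Proof.
case=> [[x y]|]; case=> [[x' y']|]; only 2,3,4: by [].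
pose c := odflt (0, 0) : _ -> rat * rat.
move=> h; have hX := congr1 (fst \o c) h; have hY := congr1 (snd \o c) h.
move: hX hY; rewrite /sX /sY; cbv beta iota delta [comp c odflt oapp to_short sX sY fst snd] => hX hY.
by have [-> ->] := short_coord_inj hX hY.
Qed.

(** Made total by sending points off the curve to 0, so that no proof of membership has to be
    carried in terms. *)
Definition spoint (P : Defs.point) : curve_point C := insubd (0 : curve_point C) (to_short E P).

Lemma spointE P : on_curve E P -> cval (spoint P) = to_short E P.
Proof. by move=> hP; rewrite /spoint insubdK // -topredE /= to_short_on. Qed.

Lemma spoint_surj (Q : curve_point C) : exists2 P, on_curve E P & spoint P = Q.
Proof.
case eQ: (cval Q) => [[X Y]|]; last first.
  by exists None => //; apply: val_inj; rewrite /= spointE // eQ.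
pose x := (X - 3 * b2 E) / 36; pose y := (Y / 108 - a1 E * x - a3 E) / 2.
have e : to_short E (Some (x, y)) = cval Q.
  by rewrite eQ /= /sX /sY /= /y /x; congr (Some (_, _)); field.
have hP : on_curve E (Some (x, y)).
  by rewrite -to_short_on e; case: (Q).
by exists (Some (x, y)) => //; apply: val_inj; rewrite /= spointE.
Qed.

Lemma padd_on P Q : on_curve E P -> on_curve E Q -> on_curve E (padd E P Q).
Proof.
move=> hP hQ; rewrite -to_short_on to_short_add // sadd_on // to_short_on //.
Qed.

Lemma pneg_on P : on_curve E P -> on_curve E (pneg E P).
Proof. by move=> hP; rewrite -to_short_on to_short_neg sneg_on ?to_short_on. Qed.

Lemma spointD P Q : on_curve E P -> on_curve E Q ->
  spoint (padd E P Q) = spoint P + spoint Q.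
Proof.
move=> hP hQ; apply: val_inj => /=.
by rewrite !spointE ?padd_on // to_short_add.
Qed.

Lemma spointN P : on_curve E P -> spoint (pneg E P) = - spoint P.
Proof.
by move=> hP; apply: val_inj; rewrite /= !spointE ?pneg_on // to_short_neg.
Qed.

Lemma spoint_eq0 P : on_curve E P -> (spoint P == 0) = (P == None).
Proof.
move=> hP; rewrite -val_eqE /= spointE // -[None in LHS]/(to_short E None).
by rewrite (inj_eq to_short_inj).
Qed.

Lemma spoint0 : spoint None = 0.
Proof. by apply/eqP; rewrite spoint_eq0. Qed.

Lemma pnmulP n P : on_curve E P ->
  on_curve E (pnmul E n P) /\ spoint (pnmul E n P) = spoint P *+ n.
Proof.
move=> hP; elim: n => [|n [on eq]]; first by rewrite /pnmul /= spoint0 mulr0n.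
rewrite /pnmul iterS -/(pnmul E n P); split; first exact: padd_on.
by rewrite spointD // eq mulrS.
Qed.

Lemma pzmulP k P : on_curve E P ->
  on_curve E (pzmul E k P) /\ spoint (pzmul E k P) = spoint P *~ k.
Proof.
move=> hP; case: k => n /=; first exact: pnmulP.
have [on eq] := pnmulP n.+1 hP.
by split; [exact: pneg_on|rewrite spointN // eq].
Qed.

Lemma lincombP Ps ns : all (on_curve E) Ps ->
  on_curve E (lincomb E Ps ns) /\
  spoint (lincomb E Ps ns) = \sum_(pn <- zip Ps ns) spoint pn.1 *~ pn.2.
Proof.
elim: Ps ns => [|P Ps IH] [|n ns] //=; rewrite ?big_nil ?spoint0 //.
move=> /andP[hP /(IH ns)[on eq]]; have [on1 eq1] := pzmulP n hP.
split; first exact: padd_on.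
by rewrite big_cons spointD // eq1 eq.
Qed.

Lemma iter_dbl_spoint n P : on_curve E P ->
  on_curve E (iter n (fun Q => padd E Q Q) P) /\
  spoint (iter n (fun Q => padd E Q Q) P) = spoint P *+ 2 ^ n.
Proof.
move=> hP; elim: n => [|n [on eq]] //.
rewrite iterS; split; first exact: padd_on.
by rewrite spointD // eq expnS mulnC mulrnA mulr2n.
Qed.

Lemma rank_dependent r : rank_is E r -> forall Q : 'I_r.+1 -> curve_point C,
  exists n : 'I_r.+1 -> int, (exists i, n i != 0) /\ \sum_i Q i *~ n i = 0.
Proof.
move=> [_ hr] Q.
have hs i : exists P : Defs.point, on_curve E P && (spoint P == Q i).
  by have [P on eq] := spoint_surj (Q i); exists P; rewrite on eq /=.
pose P i := xchoose (hs i).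
have Pon i : on_curve E (P i) by have /andP[] := xchooseP (hs i).
have PQ i : spoint (P i) = Q i by have /andP[_ /eqP] := xchooseP (hs i).
pose Ps := [seq P i | i <- enum 'I_r.+1].
have sPs : size Ps = r.+1 by rewrite size_map size_enum_ord.
have aPs : all (on_curve E) Ps by apply/allP => _ /mapP[i _ ->].
have /boolp.existsNP[ns] := hr Ps sPs aPs.
move=> /boolp.not_implyP[sns] /boolp.not_implyP[lc /negP hns].
exists (fun i => ns`_i); split.
  move: hns; rewrite -has_predC => /(has_nthP 0)[i hi ni].
  by rewrite sns sPs in hi; exists (Ordinal hi).
have [_] := lincombP ns aPs; rewrite lc spoint0 => h.
rewrite [RHS]h (big_nth (None, 0)) size_zip sns minnn sPs big_mkord.
apply: eq_bigr => i _; rewrite nth_zip //= (nth_map i) ?size_enum_ord //.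
by rewrite nth_ord_enum PQ.
Qed.

End Transfer.

(** * Quadratic forms on abelian groups *)

Section PowersOfFour.
Local Open Scope classical_set_scope.

Lemma expr4_gt0 (R : realType) n : 0 < 4 ^+ n :> R. Proof. by rewrite exprn_gt0. Qed.

Lemma cvg_inv4 (R : realType) (c : R) : ((fun n => c / 4 ^+ n) @ \oo --> (0 : R))%classic.
Proof.
have -> : (fun n => c / 4 ^+ n) = (fun n => c * (4^-1) ^+ n).
  by apply/funext => n; rewrite exprVn.
rewrite -[X in _ --> X](mulr0 c); apply: cvgMr; apply: cvg_expr.
by rewrite ger0_norm ?invr_ge0 // invf_lt1 // ltr1n.
Qed.

(** Allows the height on the minimal equation to be replaced by the one on the short model, which
    differs from it by a bounded amount. *)
Lemma cvg_div4_dist (R : realType) (a b : nat -> R) (c l : R) :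
    (forall n, `|a n - b n| <= c) ->
    ((fun n => b n / 4 ^+ n) @ \oo --> l)%classic ->
  ((fun n => a n / 4 ^+ n) @ \oo --> l)%classic.
Proof.
move=> ab cb; have cz := cvg_inv4 c.
have h1 : ((fun n => b n / 4 ^+ n) \- (fun n => c / 4 ^+ n)) @ \oo --> l.
  by rewrite -[X in _ --> X]subr0; apply: cvgB; [exact: cb|exact: cz].
have h2 : ((fun n => b n / 4 ^+ n) \+ (fun n => c / 4 ^+ n)) @ \oo --> l.
  by rewrite -[X in _ --> X]addr0; apply: cvgD; [exact: cb|exact: cz].
apply: squeeze_cvgr h1 h2; apply: nearW => n /=.
rewrite -mulrBl -mulrDl !(ler_pM2r, invr_gt0, expr4_gt0) //.
by have := ab n; rewrite ler_distl.
Qed.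

End PowersOfFour.

Section TateLimit.
Local Open Scope classical_set_scope.
Variables (R : realType) (G : zmodType) (h : G -> R) (kappa : R).
Hypothesis h_ge0 : forall x, 0 <= h x.
Hypothesis h_double : forall x, `|h (x *+ 2) - 4 * h x| <= kappa.
Hypothesis h_parallelogram :
  forall x y, h (x + y) + h (x - y) <= 2 * h x + 2 * h y + kappa.

Definition tate_seq (x : G) (n : nat) : R := h (x *+ 2 ^ n) / 4 ^+ n.
Definition tate_limit (x : G) : R := limn (tate_seq x).

Let kappa_ge0 : 0 <= kappa.
Proof. exact: le_trans (normr_ge0 _) (h_double 0). Qed.

Lemma tate_seqS x n : tate_seq x n.+1 = h (x *+ 2 ^ n *+ 2) / 4 / 4 ^+ n.
Proof. by rewrite /tate_seq -mulrnA mulnC -expnS exprS invfM mulrA. Qed.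

Lemma tate_cvg x : (tate_seq x @ \oo --> tate_limit x)%classic.
Proof.
(* [kappa / 3] is the fixed point of [c |-> (kappa + c) / 4]; adding it turns the doubling estimate
   into monotonicity. *)
pose v n := (h (x *+ 2 ^ n) + kappa / 3) / 4 ^+ n.
have cv : cvgn v.
  apply: nonincreasing_is_cvgn.
    apply/nonincreasing_seqP => n.
    rewrite /v exprS invfM mulrA ler_pM2r ?invr_gt0 ?expr4_gt0 //.
    rewrite expnS mulnC mulrnA; have := h_double (x *+ 2 ^ n).
    by rewrite ler_norml => /andP[_]; lra.
  exists 0 => _ [n _ <-]; rewrite /v divr_ge0 ?(ltW (expr4_gt0 n)) //.
  by rewrite addr_ge0 // divr_ge0.
have cc := @cvg_inv4 R (kappa / 3).
suff : cvgn (tate_seq x) by [].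
have -> : tate_seq x = v \- (fun n => (kappa / 3) / 4 ^+ n).
  by apply/funext => n; rewrite /v /tate_seq /= mulrDl addrK.
by apply: cvgP; apply: cvgB; [exact: cv|exact: cc].
Qed.

Lemma tate_dist x : `|tate_limit x - h x| <= kappa / 3.
Proof.
(* The right side is the partial geometric sum of the errors [kappa / 4 ^ (i + 1)] made at each
   doubling. *)
have b n : `|tate_seq x n - h x| <= kappa / 3 * (1 - (4 ^+ n)^-1).
  elim: n => [|n IH]; first by rewrite /tate_seq expn0 !expr0 invr1 mulr1 mulr1n !subrr normr0 mulr0.
  have -> : tate_seq x n.+1 - h x = (h (x *+ 2 ^ n *+ 2) - 4 * h (x *+ 2 ^ n)) / 4 / 4 ^+ n
      + (tate_seq x n - h x).
    by rewrite tate_seqS /tate_seq; field; rewrite expf_neq0.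
  apply: le_trans (ler_normD _ _) _.
  have e : `|(h (x *+ 2 ^ n *+ 2) - 4 * h (x *+ 2 ^ n)) / 4 / 4 ^+ n| <= kappa / 4 / 4 ^+ n.
    have := h_double (x *+ 2 ^ n); rewrite !ler_norml -!mulNr.
    by rewrite !(ler_pM2r, invr_gt0, expr4_gt0).
  rewrite exprS invfM; move: e IH; set a := (4 ^+ n)^-1; lra.
have b' n : h x - kappa / 3 <= tate_seq x n <= h x + kappa / 3.
  have : `|tate_seq x n - h x| <= kappa / 3.
    by apply: le_trans (b n) _; rewrite ler_piMr ?divr_ge0 // gerBl invr_ge0 ltW ?expr4_gt0.
  by rewrite ler_distl.
rewrite ler_distl; apply/andP; split.
  by apply: cvgr_to_ge (@tate_cvg x) _; apply: nearW => n; have /andP[] := b' n.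
by apply: cvgr_to_le (@tate_cvg x) _; apply: nearW => n; have /andP[] := b' n.
Qed.

Lemma tate_ge0 x : 0 <= tate_limit x.
Proof.
apply: cvgr_to_ge (@tate_cvg x) _; apply: nearW => n.
by rewrite divr_ge0 // ltW ?expr4_gt0.
Qed.

Lemma tate_double x : tate_limit (x *+ 2) = 4 * tate_limit x.
Proof.
have c1 : (fun n => tate_seq x n.+1) @ \oo --> tate_limit x.
  by have := @tate_cvg x; rewrite -(cvg_shiftS (tate_seq x)).
have c2 : (fun n => 4 * tate_seq x n.+1) @ \oo --> 4 * tate_limit x.
  by apply: cvgMr.
apply: cvg_unique (@tate_cvg (x *+ 2)) _ => //.
have -> // : tate_seq (x *+ 2) = (fun n => 4 * tate_seq x n.+1).
apply/funext => n; rewrite tate_seqS /tate_seq -!mulrnA mulnC.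
by field; rewrite expf_neq0.
Qed.

Let tate_parallelogram_le x y :
  tate_limit (x + y) + tate_limit (x - y) <= 2 * tate_limit x + 2 * tate_limit y.
Proof.
have c1 : (tate_seq (x + y) \+ tate_seq (x - y)) @ \oo -->
    tate_limit (x + y) + tate_limit (x - y).
  by apply: cvgD; exact: tate_cvg.
have c2 : (fun n => 2 * tate_seq x n + 2 * tate_seq y n + kappa / 4 ^+ n) @ \oo -->
    2 * tate_limit x + 2 * tate_limit y + 0.
  apply: cvgD; last exact: cvg_inv4.
  by apply: cvgD; apply: cvgMr; exact: tate_cvg.
rewrite -[X in _ <= X]addr0; apply: ler_cvg_to c1 c2 _; apply: nearW => n.
by rewrite /tate_seq /= mulrnDl mulrnBl !mulrA -!mulrDl ler_pM2r //.
Qed.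

(** An upper estimate suffices: applied to [x + y] and [x - y], whose sum and difference are [2 x]
    and [2 y], it gives the reverse inequality. *)
Lemma tate_parallelogram x y :
  tate_limit (x + y) + tate_limit (x - y) = 2 * tate_limit x + 2 * tate_limit y.
Proof.
apply/eqP; rewrite eq_le tate_parallelogram_le /=.
have := tate_parallelogram_le (x + y) (x - y).
have -> : x + y + (x - y) = x *+ 2 by rewrite addrACA subrr addr0 mulr2n.
have -> : x + y - (x - y) = y *+ 2 by rewrite opprB addrC addrA subrK mulr2n.
by rewrite !tate_double; lra.
Qed.

End TateLimit.

Section QuadraticForms.
Variables (R : realType) (G : zmodType).

Definition quadratic (q : G -> R) : Prop :=
  (forall x, 0 <= q x) /\
  (forall x y, q (x + y) + q (x - y) = 2 * q x + 2 * q y).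

Definition polar (q : G -> R) (x y : G) : R := (q (x + y) - q (x - y)) / 4.

Section Polar.
Variables (q : G -> R) (hq : quadratic q).
Let q_ge0 := hq.1.
Let q_par := hq.2.

Lemma quadratic0 : q 0 = 0.
Proof. by have := q_par 0 0; rewrite addr0 subr0; lra. Qed.

Lemma quadraticN x : q (- x) = q x.
Proof. by have := q_par 0 x; rewrite add0r sub0r quadratic0; lra. Qed.

Lemma polarC x y : polar q x y = polar q y x.
Proof. by rewrite /polar [x + y]addrC -(quadraticN (x - y)) opprB. Qed.

Lemma polar0 y : polar q 0 y = 0.
Proof. by rewrite /polar add0r sub0r quadraticN subrr mul0r. Qed.

(** Jordan and von Neumann: the parallelogram law at [u + z] and [u - z] gives [D]; adding [D x y]
    and [D y x] cancels the terms at [x - y] and [y - x]. *)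
Lemma polarD x y z : polar q (x + y) z = polar q x z + polar q y z.
Proof.
have D u v : polar q (u + v) z + polar q (u - v) z = 2 * polar q u z.
  have := q_par (u + z) v; have := q_par (u - z) v; rewrite /polar.
  by rewrite ![u + z + _]addrAC ![u - z + _]addrAC; lra.
have N u : polar q (- u) z = - polar q u z.
  by have := D 0 u; rewrite add0r sub0r polar0; lra.
by have := D x y; have := D y x; rewrite -(opprB x y) N [y + x]addrC; lra.
Qed.

Lemma polarN x z : polar q (- x) z = - polar q x z.
Proof. by have := polarD x (- x) z; rewrite subrr polar0; lra. Qed.

Lemma polarB x y z : polar q (x - y) z = polar q x z - polar q y z.
Proof. by rewrite polarD polarN. Qed.

Lemma polarMz x z n : polar q (x *~ n) z = n%:~R * polar q x z.
Proof.
have pos m : polar q (x *+ m) z = m%:R * polar q x z.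
  elim: m => [|m IH]; first by rewrite mulr0n polar0 mul0r.
  by rewrite mulrS polarD IH -addn1 natrD; ring.
by case: n => m; rewrite /intmul ?polarN !pos // mulNr.
Qed.

Lemma quadraticD x y : q (x + y) = q x + q y + 2 * polar q x y.
Proof. by have := q_par x y; rewrite /polar; lra. Qed.

Lemma polarxx x : polar q x x = q x.
Proof. by have := q_par x x; rewrite /polar subrr quadratic0; lra. Qed.

Lemma quadraticMz x n : q (x *~ n) = n%:~R ^+ 2 * q x.
Proof. by rewrite -polarxx polarMz polarC polarMz polarxx; ring. Qed.

Lemma quadratic_comb x y m n :
  0 <= m%:~R ^+ 2 * q x + n%:~R ^+ 2 * q y + 2 * m%:~R * n%:~R * polar q x y.
Proof.
have := q_ge0 (x *~ m + y *~ n).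
rewrite quadraticD !quadraticMz polarMz polarC polarMz polarC.
by congr (0 <= _); ring.
Qed.

(** Along integer multiples of [y] the form [q] is then affine and nonnegative in both directions,
    hence constant. *)
Lemma polar_le0 x y : q y = 0 -> polar q x y = 0.
Proof.
move=> y0; apply/eqP; rewrite -normr_eq0; apply/eqP.
have [//|] := eqVneq `|polar q x y| 0; rewrite -normr_gt0 normr_id => b0.
have [m hm] : exists m : nat, q x / (2 * `|polar q x y|) < m%:R.
  by exists (Num.bound (q x / (2 * `|polar q x y|))); rewrite archi_boundP // divr_ge0 ?q_ge0 ?mulr_ge0.
move: hm; rewrite ltr_pdivrMr ?mulr_gt0 // => hm.
have [p0|p0] := ger0P (polar q x y).
  have := quadratic_comb x y 1 (- m%:Z); rewrite y0 mulrNz -pmulrn.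
  by move: hm; rewrite ger0_norm //; lra.
have := quadratic_comb x y 1 m%:Z; rewrite y0 -pmulrn.
by move: hm; rewrite ltr0_norm //; lra.
Qed.

(** Only integer multiples exist in [G], so the minimizing real multiple of [y] is approximated by
    [n / m]. The rounding error contributes at most [q y ^ 2], and [m] is chosen with
    [m * e > q y ^ 2] to beat it. *)
Lemma polar_cauchy_schwarz x y : polar q x y ^+ 2 <= q x * q y.
Proof.
have [y0|yp] := eqVneq (q y) 0.
  by rewrite polar_le0 // y0 mulr0 expr0n.
have {}yp : 0 < q y by rewrite lt_neqAle eq_sym yp q_ge0.
rewrite leNgt; apply/negP => lt.
pose e := polar q x y ^+ 2 - q x * q y.
have e0 : 0 < e by rewrite subr_gt0.
have [m hm] : exists m : nat, q y ^+ 2 / e < m%:R.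
  exists (Num.bound (q y ^+ 2 / e)); rewrite archi_boundP // divr_ge0 ?ltW //.
  by rewrite exprn_gt0.
move: hm; rewrite ltr_pdivrMr // => hm.
have m1 : 1 <= m%:R :> R.
  case: m hm => [|m _]; last by rewrite ler1n.
  by rewrite mul0r ltNge sqr_ge0.
pose n := Num.floor (- (m%:R * polar q x y) / q y).
have /andP[n1 n2] := floor_itv (- (m%:R * polar q x y) / q y).
rewrite -/n ler_pdivlMr // in n1; rewrite -/n ltr_pdivrMr // intrD mulr1z in n2.
have := quadratic_comb x y m%:Z n; rewrite -pmulrn => h.
pose s := m%:R * polar q x y + n%:~R * q y.
have h1 : 0 <= s ^+ 2 - m%:R ^+ 2 * e.
  have -> : s ^+ 2 - m%:R ^+ 2 * e = q y * (m%:R ^+ 2 * q x + n%:~R ^+ 2 * q y +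
      2 * m%:R * n%:~R * polar q x y) by rewrite /s /e; ring.
  by rewrite mulr_ge0 // ltW.
have s2 : s ^+ 2 <= q y ^+ 2.
  have s0 : 0 <= - s by rewrite /s; lra.
  have s1 : - s <= q y by rewrite /s; lra.
  by rewrite -[s ^+ 2]sqrrN ler_sqr ?nnegrE.
have : m%:R * e <= m%:R ^+ 2 * e.
  apply: ler_wpM2r; first exact: ltW.
  by rewrite expr2 ler_peMl // (le_trans ler01).
lra.
Qed.

End Polar.

(** A Gram-Schmidt step: [l] is the coordinate along [y], and Cauchy-Schwarz is exactly the
    nonnegativity of what is left. *)
Lemma quadratic_proj (q : G -> R) y (l := fun x => polar q x y / Num.sqrt (q y)) :
  quadratic q -> 0 < q y -> quadratic (fun x => q x - l x ^+ 2).
Proof.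
move=> hq yp; have sp : Num.sqrt (q y) != 0 by rewrite sqrtr_eq0 -ltNge.
split=> [x|x z].
  rewrite subr_ge0 /l expr_div_n sqr_sqrtr ?(ltW yp) // ler_pdivrMr //.
  exact: polar_cauchy_schwarz.
have := hq.2 x z; rewrite /l polarD // polarB // !mulrDl mulNr; lra.
Qed.

Lemma quadratic_sum_squares r (q : G -> R) : quadratic q ->
    (forall Q : 'I_r.+1 -> G, exists n : 'I_r.+1 -> int,
      (exists i, n i != 0) /\ q (\sum_i Q i *~ n i) = 0) ->
  exists l : 'I_r -> G -> R, (forall j x y, l j (x - y) = l j x - l j y) /\
    forall x, q x = \sum_j l j x ^+ 2.
Proof.
elim: r q => [|r IH] q hq dep.
  exists (fun _ _ => 0); split=> [[]//|x]; rewrite big_ord0.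
  have [n [[i]]] := dep (fun _ => x); rewrite big_ord_recl big_ord0 addr0.
  rewrite ord1 quadraticMz // => n0 /eqP.
  by rewrite mulf_eq0 expf_eq0 /= intr_eq0 (negPf n0) => /eqP.
have [z|/existsNP[y /eqP y0]] := pselect (forall x, q x = 0).
  exists (fun _ _ => 0); split=> [j x y|x]; first by rewrite subrr.
  by rewrite z big1 // => j _; rewrite expr0n.
have yp : 0 < q y by rewrite lt_neqAle eq_sym y0 hq.1.
pose l x := polar q x y / Num.sqrt (q y).
have hq' := quadratic_proj hq yp; rewrite -/l in hq'.
have l2y : l y ^+ 2 = q y.
  by rewrite /l polarxx // expr_div_n sqr_sqrtr ?ltW // expr2 mulfK.
have [|l' [addl' el']] := IH _ hq'.
  (* [y] is put at index 0 and [Q] at the others; a relation among these [r + 2] elements descends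
     to one among the [Q] for [q - l ^ 2]. *)
  move=> Q; have [n [[i ni]]] := dep (fun i => oapp Q y (unlift ord0 i)).
  rewrite big_ord_recl unlift_none /=.
  under eq_bigr do rewrite liftK /=.
  set w := \sum_(i < _) _ => e.
  have z0 : q (y *~ n ord0 + w) - l (y *~ n ord0 + w) ^+ 2 = 0.
    by apply/eqP; rewrite eq_le hq'.1 andbT e sub0r oppr_le0 sqr_ge0.
  (* [q - l ^ 2] vanishes at [y], so by [polar_le0] adding multiples of [y] does not change it. *)
  have w0 : q w - l w ^+ 2 = 0.
    have e1 := quadraticMz hq' y (n ord0).
    have ey : q y - l y ^+ 2 = 0 by rewrite l2y subrr.
    have e2 := quadraticD hq' (y *~ n ord0) w.
    have e3 := polarMz hq' y w (n ord0); rewrite (polarC hq' y) in e3.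
    rewrite (polar_le0 hq' _ ey) mulr0 in e3.
    move: e2; rewrite z0 e1 e3; cbv beta; rewrite ey; rewrite /l; lra.
  exists (fun i => n (lift ord0 i)); split=> //.
  case: (unliftP ord0 i) ni => [j ->|->] ni; first by exists j.
  (* If only the coefficient of [y] were nonzero, the relation would read [q (n y) = 0], against
     [q y != 0]. *)
  case: (pselect (exists j, n (lift ord0 j) != 0)) => // nj; exfalso.
  have w00 : w = 0.
    rewrite /w big1 // => j _; have [->|nz] := eqVneq (n (lift ord0 j)) 0.
      by rewrite mulr0z.
    by case: nj; exists j.
  move: e; rewrite w00 addr0 quadraticMz // => /eqP.
  by rewrite mulf_eq0 expf_eq0 /= intr_eq0 (negPf ni) (negPf y0).
exists (fun j x => oapp (fun j => l' j x) (l x) (unlift ord0 j)); split.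
  move=> j x z; case: (unliftP ord0 j) => [k _|_] /=; first exact: addl'.
  by rewrite /l polarB // mulrBl.
move=> x; rewrite big_ord_recl unlift_none /=.
under eq_bigr do rewrite liftK /=.
by rewrite -el' addrC subrK.
Qed.

End QuadraticForms.

(** * Counting separated points in Euclidean space *)

Lemma card_bounded_sum r S (T : finType) (c : T -> {ffun 'I_r.+1 -> 'I_S.+1}) :
    injective c -> (forall t, (\sum_j c t j <= S)%N) ->
  (#|T| <= 2 ^ (r.+1 + S))%N.
Proof.
move=> cinj hc.
have sum2 : (\sum_(k < S.+1) 2 ^ (S - k) <= 2 ^ S.+1)%N.
  rewrite (reindex_inj rev_ord_inj) /=.
  have -> : (\sum_(j < S.+1) 2 ^ (S - (S.+1 - j.+1)) = \sum_(j < S.+1) 2 ^ j)%N.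
    by apply: eq_bigr => j _; rewrite subSS subKn // -ltnS.
  by rewrite -[X in (X <= _)%N]mul1n -(predn_exp 2) leq_pred.
(* A generating function evaluated at 1/2 and cleared of denominators: the weights factor over
   coordinates, while each tuple of sum at most [S] weighs at least [2 ^ (r * S)]. *)
have : (\sum_(f : {ffun 'I_r.+1 -> 'I_S.+1}) \prod_j 2 ^ (S - f j) <= (2 ^ S.+1) ^ r.+1)%N.
  rewrite -(bigA_distr_bigA (fun _ k => 2 ^ (S - nat_of_ord k))%N) /=.
  by rewrite prod_nat_const card_ord leq_exp2r.
have low t : (2 ^ (r * S) <= \prod_j 2 ^ (S - c t j))%N.
  rewrite -expn_sum leq_pexp2l //.
  have : (\sum_j (S - c t j) + \sum_j c t j = r.+1 * S)%N.
    rewrite -big_split /= -[in RHS](card_ord r.+1) -sum_nat_const.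
    by apply: eq_bigr => j _; rewrite subnK // -ltnS.
  by have := hc t; rewrite mulSn; lia.
move=> up; have : (#|T| * 2 ^ (r * S) <= (2 ^ S.+1) ^ r.+1)%N.
  apply: leq_trans up; rewrite -sum_nat_const.
  apply: (@leq_trans (\sum_(t : T) \prod_j 2 ^ (S - c t j))%N); first exact: leq_sum.
  rewrite -(big_imset (fun f : {ffun 'I_r.+1 -> 'I_S.+1} => \prod_j 2 ^ (S - f j))%N (A := T)) /=; last by move=> s t _ _; exact: cinj.
  rewrite [X in (_ <= X)%N](bigID (mem [set c t | t in T])) /= leq_addr //.
rewrite -expnM; have -> : (S.+1 * r.+1 = r.+1 + S + r * S)%N by lia.
by rewrite expnD leq_pmul2r // expn_gt0.
Qed.

Definition int_code (z : int) : nat :=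
  match z with Posz n => n.*2 | Negz n => n.*2.+1 end.

Lemma int_code_inj : injective int_code.
Proof. by move=> [m|m] [n|n] /=; lia. Qed.

Lemma int_code_le z : (int_code z <= 2 * `|z|)%N.
Proof. by case: z => n /=; lia. Qed.

(** Rounding to a grid whose cells have squared diameter [delta] is injective. The rounded vectors
    have l1-norm at most [r (M + 1)]; [int_code] doubles this, and
    [r + 2 r (M + 1) = r (2 M + 3)]. *)
Lemma separated_card (R : realType) r (T : finType) (v : T -> 'I_r -> R)
    (M : nat) (delta : R) : 0 < delta -> (0 < M)%N ->
    (forall t, \sum_j v t j ^+ 2 <= M%:R ^+ 2 * delta) ->
    (forall s t, s != t -> delta <= \sum_j (v s j - v t j) ^+ 2) ->
  (#|T| <= (2 ^ (2 * M + 3)) ^ r)%N.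
Proof.
case: r v => [|r] v d0 M0 hM hd.
  rewrite expn0; apply/fintype.card_le1P => s _ t; rewrite !inE.
  by apply/esym; have [//|/hd] := eqVneq t s; rewrite big_ord0 leNgt d0.
have r0 : 0 < r.+1%:R :> R by rewrite ltr0n.
pose s := Num.sqrt (delta / r.+1%:R).
have s2 : s ^+ 2 = delta / r.+1%:R by rewrite sqr_sqrtr // divr_ge0 // ltW.
have s0 : 0 < s by rewrite sqrtr_gt0 divr_gt0.
pose z t j := Num.floor (v t j / s).
have zle t j : (z t j)%:~R <= v t j / s by rewrite floor_le.
have zlt t j : v t j / s < (z t j)%:~R + 1.
  by have /andP[_] := floor_itv (v t j / s); rewrite intrD.
have Mr0 : 0 < M%:R :> R by rewrite ltr0n.
have zabs t : (\sum_j `|z t j| <= r.+1 * (M + 1))%N.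
  rewrite -(ler_nat R) natr_sum natrM natrD.
  (* The mean inequality weighted by [M] plays the part of Cauchy-Schwarz: the squares sum to at
     most [r M ^ 2], so the absolute values before rounding sum to at most [r M]. *)
  have b j : `|z t j|%:R <= (v t j ^+ 2 / s ^+ 2 / M%:R + M%:R) / 2 + 1.
    set w := v t j / s; have -> : v t j ^+ 2 / s ^+ 2 = w ^+ 2 by rewrite expr_div_n.
    have h1 : `|z t j|%:R <= `|w| + 1.
      rewrite natr_absz intr_norm.
      have := zle t j; have := zlt t j; rewrite -/w => h1 h2.
      have [w0|w0] := ger0P w; have [k0|k0] := ger0P ((z t j)%:~R : R); lra.
    apply: le_trans h1 _; rewrite lerD2r ler_pdivlMr //.
    rewrite -(ler_pM2r Mr0) mulrDl divfK ?gt_eqF // -subr_ge0 -(real_normK (num_real w)).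
    suff -> : `|w| ^+ 2 + M%:R * M%:R - `|w| * 2 * M%:R = (`|w| - M%:R) ^+ 2.
      exact: sqr_ge0.
    by ring.
  apply: le_trans (ler_sum _ (fun j _ => b j)) _.
  rewrite !big_split /= -mulr_suml big_split /= -!mulr_suml.
  rewrite !sumr_const card_ord s2 -[M%:R *+ _]mulr_natl.
  have := hM t; set S := \sum_j _ => hS.
  have -> : S / (delta / r.+1%:R) / M%:R = r.+1%:R * (S / delta / M%:R).
    by rewrite invf_div; ring.
  have : S / delta / M%:R <= M%:R.
    by rewrite ler_pdivrMr // ler_pdivrMr // -expr2.
  move=> /(ler_wpM2l (ltW r0)); lra.
have zinj t t' : (forall j, z t j = z t' j) -> t = t'.
  move=> e; apply/eqP; apply/negP => /negP ne; have := hd _ _ ne; apply/negP.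
  rewrite -ltNge.
  have b j : (v t j - v t' j) ^+ 2 < delta / r.+1%:R.
    rewrite -s2 -[X in X < _]real_normK ?num_real // ltr_sqr ?nnegrE ?(ltW s0) //.
    have e1 := zle t j; have e2 := zlt t j; have e3 := zle t' j; have e4 := zlt t' j.
    rewrite e in e1 e2; rewrite !(ler_pdivlMr, ltr_pdivrMr) // in e1 e2 e3 e4.
    by rewrite ltr_norml; apply/andP; split; lra.
  have -> : delta = \sum_(j < r.+1) delta / r.+1%:R.
    by rewrite sumr_const card_ord -[RHS]mulr_natr divfK // gt_eqF.
  apply: ltr_sum => //; by apply/hasP; exists ord0 => //; rewrite mem_index_enum.
pose S := (2 * (r.+1 * (M + 1)))%N.
have cS t : (\sum_j int_code (z t j) <= S)%N.
  apply: (@leq_trans (\sum_j 2 * `|z t j|)%N).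
    by apply: leq_sum => j _; exact: int_code_le.
  by rewrite -big_distrr /= leq_mul2l zabs orbT.
have cle t j : (int_code (z t j) < S.+1)%N.
  by rewrite ltnS; apply: leq_trans (cS t); rewrite (bigD1 j) //= leq_addr.
pose c t : {ffun 'I_r.+1 -> 'I_S.+1} := [ffun j => Ordinal (cle t j)].
have cinj : injective c.
  move=> t t' e; apply: zinj => j; apply: int_code_inj.
  by have := congr1 (fun f : {ffun 'I_r.+1 -> 'I_S.+1} => nat_of_ord (f j)) e; rewrite !ffunE.
apply: leq_trans (card_bounded_sum cinj _) _.
  move=> t; apply: leq_trans (cS t); apply: leq_sum => j _; by rewrite ffunE.
by rewrite -expnM leq_pexp2l // /S; lia.
Qed.

(** * Heights *)

(** The multiplicative Weil height, kept in [nat] so that all estimates before taking logarithms are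
    integer inequalities. *)
Definition mht (x : rat) : nat := maxn `|numq x| `|denq x|.

Lemma mht_gt0 x : (0 < mht x)%N.
Proof. by rewrite leq_max !absz_gt0 denq_eq0 orbT. Qed.

Lemma frac_multiple (x : rat) (m n : int) : x * n%:~R = m%:~R ->
  exists k : int, m = k * numq x /\ n = k * denq x.
Proof.
rewrite -{1}(divq_num_den x) => h.
have {}h : numq x * n = m * denq x.
  apply: (@intr_inj rat); rewrite !rmorphM /= -h.
  by field; rewrite intr_eq0 denq_eq0.
have : (denq x %| n)%Z.
  rewrite -(@Gauss_dvdzr _ (numq x)); first by rewrite h dvdz_mull.
  by rewrite /coprimez gcdzC; exact: coprime_num_den.
move=> /dvdzP[k ek]; exists k; split=> //; subst n.
by apply: (mulIf (denq_neq0 x)); rewrite -h; ring.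
Qed.

Lemma mht_frac_le (x : rat) (m n : int) : n != 0 -> x * n%:~R = m%:~R ->
  (mht x <= maxn `|m| `|n|)%N.
Proof.
move=> n0 /frac_multiple[k [-> en]]; have k0 : k != 0.
  by apply: contraNneq n0 => k0; rewrite en k0 mul0r.
by rewrite en !abszM -maxnMr leq_pmull ?absz_gt0.
Qed.

Lemma le_mht_frac (x : rat) (m n g : int) : g != 0 -> x * n%:~R = m%:~R ->
  (forall d : int, (d %| m)%Z -> (d %| n)%Z -> (d %| g)%Z) ->
  (maxn `|m| `|n| <= `|g| * mht x)%N.
Proof.
move=> g0 /frac_multiple[k [-> ->]] hg.
have : (k %| g)%Z by apply: hg; rewrite dvdz_mulr.
rewrite -absz_gt0 in g0; rewrite dvdzE => /(dvdn_leq g0) kg.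
by rewrite !abszM -maxnMr leq_mul2r kg orbT.
Qed.

(** Up to sign the three bounded quantities are the coefficients of [(q T - p)(t T - s)]. If one
    product exceeded [2 M], the complementary one would exceed [M], yet both together are a product
    of two outer coefficients, at most [M ^ 2]. *)
Lemma max_mul_le (F : realFieldType) (p q s t M : F) :
  `|q * t| <= M -> `|p * t + q * s| <= M -> `|p * s| <= M ->
  Num.max `|p| `|q| * Num.max `|s| `|t| <= 2 * M.
Proof.
rewrite !normrM => h0 h1 h2.
have M0 : 0 <= M by apply: le_trans h1; exact: normr_ge0.
have aux u v w z : 0 <= u -> 0 <= v -> 0 <= w -> 0 <= z -> u * z <= M -> w * v <= M ->
    u * v <= M + w * z -> u * v <= 2 * M :> F.
  move=> u0 v0 w0 z0 e1 e2 e3; rewrite leNgt; apply/negP => lt.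
  have lt2 : M < w * z by lra.
  have : M * M < (u * v) * (w * z) by nra.
  have : (u * z) * (w * v) <= M * M by apply: ler_pM => //; exact: mulr_ge0.
  have -> : u * v * (w * z) = u * z * (w * v) by ring.
  by move=> a b; have := le_lt_trans a b; rewrite ltxx.
have n1 : `|p| * `|t| <= M + `|q| * `|s|.
  rewrite -!normrM -lerBlDr; apply: le_trans h1.
  by have := lerB_normD (p * t) (q * s).
have n2 : `|q| * `|s| <= M + `|p| * `|t|.
  rewrite -!normrM -lerBlDr; apply: le_trans h1; rewrite [p * t + _]addrC.
  by have := lerB_normD (q * s) (p * t).
case: (leP `|p| `|q|) => _; case: (leP `|s| `|t|) => _.
- by lra.
- by apply: (aux _ _ `|p| `|t|) => //.
- by apply: (aux _ _ `|q| `|s|) => //.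
- by lra.
Qed.

(* Gauss's lemma for [(q T - p)(t T - s)]. *)
Lemma primitive_product (p q s t : int) : coprimez p q -> coprimez s t ->
  exists x y z : int, q * t * x + (p * t + q * s) * y + p * s * z = 1.
Proof.
move=> /coprimezP[[u v] /= e1] /coprimezP[[w z] /= e2].
pose a := u * w * (p * s) + v * z * (q * t).
pose b := u * z * (p * t) + v * w * (q * s).
exists (v * z * (a + 2 * b)), (u ^+ 2 * z ^+ 2 * p * t + v ^+ 2 * w ^+ 2 * q * s),
  (u * w * (a + 2 * b) + 2 * u * z * v * w * (q * t)
      - (u ^+ 2 * z ^+ 2 + v ^+ 2 * w ^+ 2) * (q * t)).
transitivity (((u * p + v * q) * (w * s + z * t)) ^+ 2).
  by rewrite /a /b; ring.
by rewrite e1 e2 mulr1 expr1n.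
Qed.

(** [x] and [y] are the roots of [e0 T ^ 2 - e1 T + e2], which by Gauss's lemma is an integer
    multiple of the primitive [(q T - p)(t T - s)]. *)
Lemma mht_mul_le (x y : rat) (e0 e1 e2 : int) (M : nat) : e0 != 0 ->
    (x + y) * e0%:~R = e1%:~R -> x * y * e0%:~R = e2%:~R ->
    (`|e0| <= M)%N -> (`|e1| <= M)%N -> (`|e2| <= M)%N ->
  (mht x * mht y <= 2 * M)%N.
Proof.
move=> n0 h1 h2 b0 b1 b2.
pose p := numq x; pose q := denq x; pose s := numq y; pose t := denq y.
have q0 : q != 0 by rewrite denq_neq0.
have t0 : t != 0 by rewrite denq_neq0.
have ex : x = p%:~R / q%:~R by rewrite divq_num_den.
have ey : y = s%:~R / t%:~R by rewrite divq_num_den.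
have i1 : (p * t + q * s) * e0 = e1 * (q * t).
  apply: (@intr_inj rat); rewrite !(rmorphM, rmorphD) /= -h1 ex ey.
  by field; rewrite !intr_eq0 q0 t0.
have i2 : (p * s) * e0 = e2 * (q * t).
  apply: (@intr_inj rat); rewrite !(rmorphM, rmorphD) /= -h2 ex ey.
  by field; rewrite !intr_eq0 q0 t0.
have : (q * t %| e0)%Z.
  have [||X [Y [Z e]]] := @primitive_product p q s t; try exact: coprime_num_den.
  rewrite -[e0]mulr1 -e !mulrDr !mulrA.
  have -> : e0 * q * t * X + e0 * (p * t + q * s) * Y + e0 * p * s * Z =
      (e0 * X + e1 * Y + e2 * Z) * (q * t).
    rewrite -[e0 * p * s]mulrA [e0 * (p * s)]mulrC i2.
    by rewrite [e0 * (_ + _)]mulrC i1; ring.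
  exact: dvdz_mull.
move=> /dvdzP[k ek].
have k0 : k != 0 by apply: contraNneq n0 => k0; rewrite ek k0 mul0r.
have qt0 : q * t != 0 by rewrite mulf_neq0.
have f1 : e1 = k * (p * t + q * s) by apply: (mulIf qt0); rewrite -i1 ek; ring.
have f2 : e2 = k * (p * s) by apply: (mulIf qt0); rewrite -i2 ek; ring.
have kb e : (`|(k * e)%R| <= M)%N -> `|e%:~R : rat| <= M%:R.
  move=> h; rewrite -intr_norm -natr_absz ler_nat; apply: leq_trans h.
  by rewrite abszM leq_pmull // absz_gt0.
have := @max_mul_le rat p%:~R q%:~R s%:~R t%:~R M%:R.
rewrite -!rmorphM -rmorphD /= !kb -?ek -?f1 -?f2 // => /(_ isT isT isT).
rewrite -!intr_norm -!natr_absz -!natr_max.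
by rewrite -!natrM ler_nat.
Qed.

Section PolynomialBounds.
Variable F : realFieldType.
Implicit Types x y X Y : F.

Lemma normD_le x y X Y : `|x| <= X -> `|y| <= Y -> `|x + y| <= X + Y.
Proof. by move=> h k; apply: le_trans (ler_normD _ _) (lerD h k). Qed.

Lemma normN_le x X : `|x| <= X -> `|- x| <= X.
Proof. by rewrite normrN. Qed.

Lemma normM_le x y X Y : `|x| <= X -> `|y| <= Y -> `|x * y| <= X * Y.
Proof. by move=> h k; rewrite normrM ler_pM. Qed.

Lemma normX_le x X n : `|x| <= X -> `|x ^+ n| <= X ^+ n.
Proof. by move=> h; rewrite normrX lerXn2r // nnegrE // (le_trans _ h). Qed.

Lemma norm_nat_le n : `|n%:R : F| <= n%:R. Proof. by rewrite normr_nat. Qed.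

Lemma pow_chain (m K : F) : 1 <= m -> 0 <= K ->
  [/\ 0 <= K, K <= m * K, m * K <= m ^+ 2 * K, m ^+ 2 * K <= m ^+ 3 * K
    & m ^+ 3 * K <= m ^+ 4 * K /\ m ^+ 4 * K <= m ^+ 5 * K].
Proof.
move=> m1 K0; have s n : m ^+ n * K <= m ^+ n.+1 * K.
  apply: ler_wpM2r => //; rewrite exprS ler_peMl // exprn_ge0 //.
  exact: le_trans m1.
by have := s 0%N; rewrite expr0 mul1r expr1 => s0; have := s 1%N; rewrite expr1; split.
Qed.

(** Bounds a polynomial by the same expression in the bounds with all signs positive; [pow_chain]
    then lets linear arithmetic raise each monomial to the top power of [m]. *)
Ltac norm_bound := repeat first
  [ eassumption | eapply norm_nat_le | eapply normX_le | eapply normN_le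
  | eapply normM_le | eapply normD_le ].

Variables (A B a b c d m H K : F).
Hypotheses (hA : `|A| <= m) (hB : `|B| <= m) (m1 : 1 <= m).
Hypotheses (ha : `|a| <= H) (hb : `|b| <= H) (hc : `|c| <= K) (hd : `|d| <= K).

Let H0 : 0 <= H := le_trans (normr_ge0 a) ha.
Let K0 : 0 <= K := le_trans (normr_ge0 c) hc.

Lemma double_num_bound :
  `|a ^+ 4 - 2 * A * a ^+ 2 * b ^+ 2 - 8 * B * a * b ^+ 3 + A ^+ 2 * b ^+ 4|
    <= 12 * m ^+ 2 * H ^+ 4.
Proof.
apply: le_trans; first by norm_bound.
by have [] := pow_chain m1 (exprn_ge0 4 H0); lra.
Qed.

Lemma double_den_bound :
  `|4 * b * (a ^+ 3 + A * a * b ^+ 2 + B * b ^+ 3)| <= 12 * m ^+ 2 * H ^+ 4.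
Proof.
apply: le_trans; first by norm_bound.
by have [] := pow_chain m1 (exprn_ge0 4 H0); lra.
Qed.

Let HK : 0 <= H ^+ 2 * K ^+ 2. Proof. by rewrite mulr_ge0 ?exprn_ge0. Qed.

Lemma sum_bound0 : `|(a * d - c * b) ^+ 2| <= 12 * m ^+ 2 * (H ^+ 2 * K ^+ 2).
Proof.
apply: le_trans; first by norm_bound.
by have [] := pow_chain m1 HK; lra.
Qed.

Lemma sum_bound1 :
  `|2 * ((a * d + c * b) * (A * b * d + a * c) + 2 * B * b ^+ 2 * d ^+ 2)|
    <= 12 * m ^+ 2 * (H ^+ 2 * K ^+ 2).
Proof.
apply: le_trans; first by norm_bound.
by have [] := pow_chain m1 HK; lra.
Qed.

Lemma sum_bound2 :
  `|(a * c - A * b * d) ^+ 2 - 4 * B * b * d * (a * d + c * b)|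
    <= 12 * m ^+ 2 * (H ^+ 2 * K ^+ 2).
Proof.
apply: le_trans; first by norm_bound.
by have [] := pow_chain m1 HK; lra.
Qed.

Let H3 := exprn_ge0 3 H0.

Lemma resultant_bound_f1 : `|12 * a ^+ 2 * b + 16 * A * b ^+ 3| <= 400 * m ^+ 5 * H ^+ 3.
Proof.
apply: le_trans; first by norm_bound.
by have [? ? ? ? []] := pow_chain m1 H3; lra.
Qed.

Lemma resultant_bound_g1 :
  `|3 * a ^+ 3 - 5 * A * a * b ^+ 2 - 27 * B * b ^+ 3| <= 400 * m ^+ 5 * H ^+ 3.
Proof.
apply: le_trans; first by norm_bound.
by have [? ? ? ? []] := pow_chain m1 H3; lra.
Qed.

Lemma resultant_bound_f2 :
  `|4 * (4 * A ^+ 3 + 27 * B ^+ 2) * a ^+ 3 - 4 * A ^+ 2 * B * a ^+ 2 * b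
    + 4 * A * (3 * A ^+ 3 + 22 * B ^+ 2) * a * b ^+ 2
    + 12 * B * (A ^+ 3 + 8 * B ^+ 2) * b ^+ 3| <= 400 * m ^+ 5 * H ^+ 3.
Proof.
apply: le_trans; first by norm_bound.
by have [? ? ? ? []] := pow_chain m1 H3; lra.
Qed.

Lemma resultant_bound_g2 :
  `|A ^+ 2 * B * a ^+ 3 + A * (5 * A ^+ 3 + 32 * B ^+ 2) * a ^+ 2 * b
    + 2 * B * (13 * A ^+ 3 + 96 * B ^+ 2) * a * b ^+ 2
    - 3 * A ^+ 2 * (A ^+ 3 + 8 * B ^+ 2) * b ^+ 3| <= 400 * m ^+ 5 * H ^+ 3.
Proof.
apply: le_trans; first by norm_bound.
by have [? ? ? ? []] := pow_chain m1 H3; lra.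
Qed.

End PolynomialBounds.

(* The resultant of the numerator and the denominator of the duplication formula
   is a constant multiple of the discriminant (Silverman, The Arithmetic of
   Elliptic Curves, VIII 4.3). *)
Lemma resultant1 (R : comPzRingType) (A B a b : R) :
  (12 * a ^+ 2 * b + 16 * A * b ^+ 3)
    * (a ^+ 4 - 2 * A * a ^+ 2 * b ^+ 2 - 8 * B * a * b ^+ 3 + A ^+ 2 * b ^+ 4)
  - (3 * a ^+ 3 - 5 * A * a * b ^+ 2 - 27 * B * b ^+ 3)
    * (4 * b * (a ^+ 3 + A * a * b ^+ 2 + B * b ^+ 3))
  = 4 * (4 * A ^+ 3 + 27 * B ^+ 2) * b ^+ 7.
Proof. by ring. Qed.

Lemma resultant2 (R : comPzRingType) (A B a b : R) :
  (4 * (4 * A ^+ 3 + 27 * B ^+ 2) * a ^+ 3 - 4 * A ^+ 2 * B * a ^+ 2 * b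
    + 4 * A * (3 * A ^+ 3 + 22 * B ^+ 2) * a * b ^+ 2
    + 12 * B * (A ^+ 3 + 8 * B ^+ 2) * b ^+ 3)
    * (a ^+ 4 - 2 * A * a ^+ 2 * b ^+ 2 - 8 * B * a * b ^+ 3 + A ^+ 2 * b ^+ 4)
  + (A ^+ 2 * B * a ^+ 3 + A * (5 * A ^+ 3 + 32 * B ^+ 2) * a ^+ 2 * b
    + 2 * B * (13 * A ^+ 3 + 96 * B ^+ 2) * a * b ^+ 2
    - 3 * A ^+ 2 * (A ^+ 3 + 8 * B ^+ 2) * b ^+ 3)
    * (4 * b * (a ^+ 3 + A * a * b ^+ 2 + B * b ^+ 3))
  = 4 * (4 * A ^+ 3 + 27 * B ^+ 2) * a ^+ 7.
Proof. by ring. Qed.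

Lemma absz_le_rat (e : int) (n : nat) : (`|e| <= n)%N = (`|e%:~R : rat| <= n%:R).
Proof. by rewrite -intr_norm -natr_absz ler_nat. Qed.

Lemma numqE (x : rat) : (numq x)%:~R = x * (denq x)%:~R.
Proof. by rewrite -{2}(divq_num_den x) divfK // intr_eq0 denq_eq0. Qed.

Definition mhp (P : option (rat * rat)) : nat :=
  if P is Some (x, _) then mht x else 1.

Lemma mhp_gt0 P : (0 < mhp P)%N.
Proof. by case: P => [[x y]|] //=; exact: mht_gt0. Qed.

Lemma double_coord (F : realFieldType) (A B x y : F) : y != 0 ->
    y ^+ 2 = x ^+ 3 + A * x + B ->
  (slope A x y x y ^+ 2 - x - x) * (4 * (x ^+ 3 + A * x + B)) =
    x ^+ 4 - 2 * A * x ^+ 2 - 8 * B * x + A ^+ 2.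
Proof.
move=> y0 e; rewrite /slope eqxx -e.
have -> : (((3 * x ^+ 2 + A) / (2 * y)) ^+ 2 - x - x) * (4 * y ^+ 2) =
  (3 * x ^+ 2 + A) ^+ 2 - 8 * x * y ^+ 2 by field; rewrite y0.
by rewrite e; ring.
Qed.

(** [y2 |-> - y2] exchanges the abscissas of [P + Q] and [P - Q], so their sum and product involve
    only [y1 ^ 2] and [y2 ^ 2], hence only [x1] and [x2]. *)
Lemma sum_coord (F : realFieldType) (A B x1 y1 x2 y2 : F) : x1 != x2 ->
    y1 ^+ 2 = x1 ^+ 3 + A * x1 + B -> y2 ^+ 2 = x2 ^+ 3 + A * x2 + B ->
  let xp := slope A x1 y1 x2 y2 ^+ 2 - x1 - x2 in
  let xm := slope A x1 y1 x2 (- y2) ^+ 2 - x1 - x2 in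
  (xp + xm) * (x1 - x2) ^+ 2 = 2 * ((x1 + x2) * (A + x1 * x2) + 2 * B) /\
  xp * xm * (x1 - x2) ^+ 2 = (x1 * x2 - A) ^+ 2 - 4 * B * (x1 + x2).
Proof.
move=> n12 e1 e2 /=; rewrite /slope (negPf n12).
have d0 : x2 - x1 != 0 by rewrite subr_eq0 eq_sym.
split.
  have -> : (((y2 - y1) / (x2 - x1)) ^+ 2 - x1 - x2
      + (((- y2 - y1) / (x2 - x1)) ^+ 2 - x1 - x2)) * (x1 - x2) ^+ 2 =
    2 * y1 ^+ 2 + 2 * y2 ^+ 2 - 2 * (x1 + x2) * (x1 - x2) ^+ 2 by field; rewrite d0.
  by rewrite e1 e2; ring.
have -> : (((y2 - y1) / (x2 - x1)) ^+ 2 - x1 - x2)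
      * (((- y2 - y1) / (x2 - x1)) ^+ 2 - x1 - x2) * (x1 - x2) ^+ 2 =
    ((y2 ^+ 2 - y1 ^+ 2) ^+ 2 - 2 * (y1 ^+ 2 + y2 ^+ 2) * (x1 + x2) * (x1 - x2) ^+ 2
      + ((x1 + x2) * (x1 - x2) ^+ 2) ^+ 2) / (x2 - x1) ^+ 2 by field; rewrite d0.
by rewrite e1 e2; field; rewrite d0.
Qed.

Section CurveHeights.
Variables (C : curve rat) (A B : int) (m : nat).
Hypotheses (eA : cA C = A%:~R) (eB : cB C = B%:~R).
Hypotheses (m_gt0 : (0 < m)%N) (Am : (`|A| <= m)%N) (Bm : (`|B| <= m)%N).

Let m1 : (1 : rat) <= m%:R. Proof. by rewrite ler1n. Qed.
Let hA : `|A%:~R : rat| <= m%:R. Proof. by rewrite -absz_le_rat. Qed.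
Let hB : `|B%:~R : rat| <= m%:R. Proof. by rewrite -absz_le_rat. Qed.

Let hnum (x : rat) : `|(numq x)%:~R : rat| <= (mht x)%:R.
Proof. by rewrite -absz_le_rat leq_maxl. Qed.
Let hden (x : rat) : `|(denq x)%:~R : rat| <= (mht x)%:R.
Proof. by rewrite -absz_le_rat leq_maxr. Qed.

Definition double_num (x : rat) (a := numq x) (b := denq x) : int :=
  a ^+ 4 - 2 * A * a ^+ 2 * b ^+ 2 - 8 * B * a * b ^+ 3 + A ^+ 2 * b ^+ 4.
Definition double_den (x : rat) (a := numq x) (b := denq x) : int :=
  4 * b * (a ^+ 3 + A * a * b ^+ 2 + B * b ^+ 3).

Let absz_le_nat (e : int) (n : nat) : `|e%:~R : rat| <= n%:R -> (`|e| <= n)%N.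
Proof. by rewrite absz_le_rat. Qed.

Let dnumr x (a : rat := (numq x)%:~R) (b : rat := (denq x)%:~R)
    (A' : rat := A%:~R) (B' : rat := B%:~R) :
  (double_num x)%:~R = a ^+ 4 - 2 * A' * a ^+ 2 * b ^+ 2 - 8 * B' * a * b ^+ 3 + A' ^+ 2 * b ^+ 4.
Proof. by rewrite /double_num /a /b /A' /B'; ring. Qed.

Let ddenr x (a : rat := (numq x)%:~R) (b : rat := (denq x)%:~R)
    (A' : rat := A%:~R) (B' : rat := B%:~R) :
  (double_den x)%:~R = 4 * b * (a ^+ 3 + A' * a * b ^+ 2 + B' * b ^+ 3).
Proof. by rewrite /double_den /a /b /A' /B'; ring. Qed.

Let dnum_le x : (`|double_num x| <= 12 * m ^ 2 * mht x ^ 4)%N.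
Proof.
apply: absz_le_nat; rewrite dnumr 2!natrM !natrX; exact: double_num_bound.
Qed.

Let dden_le x : (`|double_den x| <= 12 * m ^ 2 * mht x ^ 4)%N.
Proof.
apply: absz_le_nat; rewrite ddenr 2!natrM !natrX; exact: double_den_bound.
Qed.

Lemma double_denE x : (double_den x)%:~R = 4 * (x ^+ 3 + cA C * x + cB C) * (denq x)%:~R ^+ 4.
Proof. by rewrite ddenr numqE eA eB; ring. Qed.

Let dnumE x : (double_num x)%:~R = (x ^+ 4 - 2 * cA C * x ^+ 2 - 8 * cB C * x + cA C ^+ 2)
   * (denq x)%:~R ^+ 4.
Proof. by rewrite dnumr numqE eA eB; ring. Qed.

Lemma double_coord_frac x y : on_short C (Some (x, y)) -> y != 0 ->
  double_den x != 0 /\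
  exists X Y, sadd (cA C) (Some (x, y)) (Some (x, y)) = Some (X, Y) /\
    X * (double_den x)%:~R = (double_num x)%:~R.
Proof.
move=> /eqP e y0; split.
  rewrite -(intr_eq0 rat) double_denE -e; apply: mulf_neq0.
    by apply: mulf_neq0; [rewrite pnatr_eq0|rewrite expf_neq0].
  by apply: expf_neq0; rewrite intr_eq0 denq_eq0.
have nY : (y == - y) = false.
  apply: negbTE; rewrite -addr_eq0 -mulr2n -mulr_natl; apply: mulf_neq0 => //.
rewrite /sadd eqxx nY /=; do 2 eexists; split; first by [].
by rewrite double_denE dnumE mulrA (double_coord y0 e).
Qed.

Lemma mhp_double_le (P : curve_point C) : (mhp (P *+ 2) <= 12 * m ^ 2 * mhp P ^ 4)%N.
Proof.
rewrite mulr2n cvalD; case: P => [[[x y]|] hP] /=; last first.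
  by rewrite muln1 muln_gt0 expn_gt0 m_gt0.
have [y0|y0] := eqVneq y 0.
  by rewrite y0 eqxx oppr0 eqxx /= !(muln_gt0, expn_gt0) m_gt0 mht_gt0.
have [d0 [X [Y [e h]]]] := double_coord_frac hP y0.
rewrite -/(sadd (cA C) (Some (x, y)) (Some (x, y))) e /=.
by apply: leq_trans (mht_frac_le d0 h) _; rewrite geq_max dnum_le dden_le.
Qed.

Let D : int := 4 * (4 * A ^+ 3 + 27 * B ^+ 2).

Let D_neq0 : D != 0.
Proof.
rewrite /D mulf_neq0 //; have := curve_nonsing C; rewrite eA eB.
by apply: contraNneq => /(congr1 (intr : int -> rat)) h; apply/eqP; move: h; rewrite rmorph0 => <-; ring.
Qed.

(** By the two resultant identities such a [d] divides [D a ^ 7] and [D b ^ 7], and [a ^ 7], [b ^ 7]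
    are coprime. *)
Let dvd_D x d : (d %| double_num x)%Z -> (d %| double_den x)%Z -> (d %| D)%Z.
Proof.
move=> h1 h2.
have : coprimez (numq x ^+ 7) (denq x ^+ 7).
  by rewrite /coprimez; apply: coprimezXl; apply: coprimezXr; exact: coprime_num_den.
move=> /coprimezP[[u v] /= e].
have ha : (d %| D * numq x ^+ 7)%Z.
  by rewrite /D -(resultant2 A B (numq x) (denq x)) rpredD // dvdz_mull.
have hb : (d %| D * denq x ^+ 7)%Z.
  by rewrite /D -(resultant1 A B (numq x) (denq x)) rpredB // dvdz_mull.
have -> : D = u * (D * numq x ^+ 7) + v * (D * denq x ^+ 7).
  by rewrite -[LHS]mulr1 -e; ring.
by rewrite rpredD // dvdz_mull.
Qed.

Let f1 x (a := numq x) (b := denq x) : `|((12 * a ^+ 2 * b + 16 * A * b ^+ 3))%:~R : rat| <= 400 * m%:R ^+ 5 * (mht x)%:R ^+ 3.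
Proof.
apply: etrans (resultant_bound_f1 hA m1 (hnum x) (hden x)).
by congr (`|_| <= _); rewrite /a /b; ring.
Qed.

Let g1 x (a := numq x) (b := denq x) : `|((- (3 * a ^+ 3 - 5 * A * a * b ^+ 2 - 27 * B * b ^+ 3)%R))%:~R : rat| <= 400 * m%:R ^+ 5 * (mht x)%:R ^+ 3.
Proof.
apply: etrans (resultant_bound_g1 hA hB m1 (hnum x) (hden x)).
by rewrite -normrN; congr (`|_| <= _); rewrite /a /b; ring.
Qed.

Let f2 x (a := numq x) (b := denq x) : `|((4 * (4 * A ^+ 3 + 27 * B ^+ 2) * a ^+ 3 - 4 * A ^+ 2 * B * a ^+ 2 * b
    + 4 * A * (3 * A ^+ 3 + 22 * B ^+ 2) * a * b ^+ 2
    + 12 * B * (A ^+ 3 + 8 * B ^+ 2) * b ^+ 3))%:~R : rat| <= 400 * m%:R ^+ 5 * (mht x)%:R ^+ 3.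
Proof.
apply: etrans (resultant_bound_f2 hA hB m1 (hnum x) (hden x)).
by congr (`|_| <= _); rewrite /a /b; ring.
Qed.

Let g2 x (a := numq x) (b := denq x) : `|((A ^+ 2 * B * a ^+ 3 + A * (5 * A ^+ 3 + 32 * B ^+ 2) * a ^+ 2 * b
    + 2 * B * (13 * A ^+ 3 + 96 * B ^+ 2) * a * b ^+ 2
    - 3 * A ^+ 2 * (A ^+ 3 + 8 * B ^+ 2) * b ^+ 3))%:~R : rat| <= 400 * m%:R ^+ 5 * (mht x)%:R ^+ 3.
Proof.
apply: etrans (resultant_bound_g2 hA hB m1 (hnum x) (hden x)).
by congr (`|_| <= _); rewrite /a /b; ring.
Qed.

(** The resultant identity for whichever of [a], [b] attains the height is divided by [mht x ^ 3].
    The factor [|D|] stays on the left: it later cancels the bound [|D|] for the common factor lost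
    in reducing the fraction. *)
Let num_den_lower x M : (`|double_num x| <= M)%N -> (`|double_den x| <= M)%N ->
  (mht x ^ 4 * `|D| <= 800 * m ^ 5 * M)%N.
Proof.
move=> hF hG.
have comb (u v F G : int) : `|u%:~R : rat| <= 400 * m%:R ^+ 5 * (mht x)%:R ^+ 3 ->
    `|v%:~R : rat| <= 400 * m%:R ^+ 5 * (mht x)%:R ^+ 3 -> (`|F| <= M)%N -> (`|G| <= M)%N ->
    (`|(u * F + v * G)%R| <= 800 * m ^ 5 * mht x ^ 3 * M)%N.
  rewrite !absz_le_rat rmorphD !rmorphM /= => hu hv {}hF {}hG.
  apply: le_trans (normD_le (normM_le hu hF) (normM_le hv hG)) _.
  by rewrite !natrM -subr_ge0 le_eqVlt; apply/orP; left; apply/eqP; ring.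
have H7 : (mht x ^ 7 * `|D| <= 800 * m ^ 5 * mht x ^ 3 * M)%N.
  have [e|e] : mht x = `|numq x|%N \/ mht x = `|denq x|%N.
    - by rewrite /mht; case: (leqP `|numq x| `|denq x|); [right|left].
    rewrite [X in (X ^ 7 * _)%N]e; have := comb _ _ _ _ (f2 x) (g2 x) hF hG.
    rewrite /double_num /double_den resultant2 -/D abszM abszX mulnC; exact: leq_trans.
  rewrite [X in (X ^ 7 * _)%N]e; have := comb _ (- _) _ _ (f1 x) (g1 x) hF hG.
  rewrite /double_num /double_den mulNr resultant1 -/D abszM abszX mulnC; exact: leq_trans.
have H3 : (0 < mht x ^ 3)%N by rewrite expn_gt0 mht_gt0.
rewrite -(leq_pmul2l H3); apply: leq_trans (leq_trans H7 _).
  by rewrite mulnA -expnD.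
by rewrite mulnCA mulnA.
Qed.

Lemma mhp_double_ge (P : curve_point C) : (mhp P ^ 4 <= 800 * m ^ 5 * mhp (P *+ 2))%N.
Proof.
rewrite mulr2n cvalD; case: P => [[[x y]|] hP] /=; last first.
  by rewrite exp1n muln1 muln_gt0 expn_gt0 m_gt0.
have D0 : (0 < `|D|)%N by rewrite absz_gt0.
have [y0|y0] := eqVneq y 0.
  have d0 : double_den x = 0.
    apply/eqP; rewrite -(intr_eq0 rat) double_denE; move/eqP: hP => <-.
    by rewrite y0 expr0n mulr0 mul0r.
  rewrite y0 eqxx oppr0 eqxx /= -(leq_pmul2r D0) muln1.
  (* At a 2-torsion point the denominator is 0, so the numerator is a common divisor of both and
     divides [D]. *)
  have hF : (`|double_num x| <= `|D|)%N.
    by apply: dvdn_leq => //; rewrite -dvdzE; apply: (@dvd_D x) => //; rewrite d0.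
  by apply: num_den_lower => //; rewrite d0.
have [d0 [X [Y [e h]]]] := double_coord_frac hP y0.
rewrite -/(sadd (cA C) (Some (x, y)) (Some (x, y))) e /=.
have := le_mht_frac D_neq0 h (@dvd_D x); rewrite geq_max => /andP[h1 h2].
by rewrite -(leq_pmul2r D0) -mulnA [(mht X * _)%N]mulnC; exact: num_den_lower.
Qed.

Lemma mhp_parallelogram (P Q : curve_point C) :
  (mhp (P + Q)%R * mhp (P - Q)%R <= 24 * m ^ 2 * (mhp P ^ 2 * mhp Q ^ 2))%N.
Proof.
have [->|P0] := eqVneq P 0.
  rewrite add0r sub0r.
  have -> : mhp (- Q) = mhp Q by case: Q => [[[x y]|] hQ].
  by rewrite /= exp1n mul1n mulnn leq_pmull // muln_gt0 expn_gt0 m_gt0.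
have [->|Q0] := eqVneq Q 0.
  by rewrite addr0 subr0 /= exp1n muln1 mulnn leq_pmull // muln_gt0 expn_gt0 m_gt0.
have dbl (R : curve_point C) : (mhp (R *+ 2) <= 24 * m ^ 2 * (mhp R ^ 2 * mhp R ^ 2))%N.
  apply: leq_trans (mhp_double_le R) _; rewrite -expnD leq_mul2r.
  by rewrite leq_mul2r orbT orbT.
have [->|nPQ] := eqVneq P Q.
  by rewrite subrr muln1 -mulr2n dbl.
have [->|nPNQ] := eqVneq P (- Q).
  rewrite addNr mul1n -opprD -mulr2n.
  have mN (R : curve_point C) : mhp (- R) = mhp R by case: R => [[[x y]|] hR].
  by rewrite !mN dbl.
case: P Q P0 Q0 nPQ nPNQ => [[[x1 y1]|] hP] [[[x2 y2]|] hQ];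
  rewrite -!val_eqE //= => _ _ nPQ nPNQ.
have /eqP e1 := hP; have /eqP e2 := hQ.
have n12 : x1 != x2.
  apply/eqP => ex; subst x2.
  have : (y1 - y2) * (y1 + y2) = 0 by rewrite -subr_sqr e1 e2 subrr.
  move/eqP; rewrite mulf_eq0 subr_eq0 addr_eq0 => /orP[] /eqP ey.
    by case/eqP: nPQ; rewrite ey.
  by case/eqP: nPNQ; rewrite ey.
have [hs hp] := sum_coord n12 e1 e2.
rewrite (negPf n12) /=; move: hs hp.
set xp := (_ - x1 - x2); set xm := (_ - x1 - x2) => hs hp.
pose a := numq x1; pose b := denq x1; pose c := numq x2; pose d := denq x2.
have b0 : b%:~R != 0 :> rat by rewrite intr_eq0 denq_eq0.
have d0 : d%:~R != 0 :> rat by rewrite intr_eq0 denq_eq0.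
have ea : a%:~R = x1 * b%:~R by exact: numqE.
have ec : c%:~R = x2 * d%:~R by exact: numqE.
pose e_0 := (a * d - c * b) ^+ 2.
pose e_1 := 2 * ((a * d + c * b) * (A * b * d + a * c) + 2 * B * b ^+ 2 * d ^+ 2).
pose e_2 := (a * c - A * b * d) ^+ 2 - 4 * B * b * d * (a * d + c * b).
have E0 : e_0%:~R = (x1 - x2) ^+ 2 * (b%:~R * d%:~R) ^+ 2 :> rat.
  by rewrite /e_0 rmorphXn rmorphB !rmorphM /= ea ec; ring.
have := @mht_mul_le xp xm e_0 e_1 e_2 (12 * m ^ 2 * (mht x1 ^ 2 * mht x2 ^ 2)).
rewrite !mulnA; apply.
- rewrite -(intr_eq0 rat) E0; apply: mulf_neq0; apply: expf_neq0.
    by rewrite subr_eq0.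
  exact: mulf_neq0.
- rewrite E0 mulrA hs eA eB /e_1.
  transitivity (2 * ((a%:~R * d%:~R + c%:~R * b%:~R) * (A%:~R * b%:~R * d%:~R + a%:~R * c%:~R)
    + 2 * B%:~R * b%:~R ^+ 2 * d%:~R ^+ 2) : rat); last by ring.
  by rewrite ea ec; ring.
- rewrite E0 mulrA hp eA eB /e_2.
  transitivity ((a%:~R * c%:~R - A%:~R * b%:~R * d%:~R) ^+ 2
    - 4 * B%:~R * b%:~R * d%:~R * (a%:~R * d%:~R + c%:~R * b%:~R) : rat); last by ring.
  by rewrite ea ec; ring.
- rewrite absz_le_rat !natrM -!mulrA.
  apply: etrans (sum_bound0 m1 (hnum x1) (hden x1) (hnum x2) (hden x2)).
  by congr (`|_| <= _); rewrite /e_0 -/a -/b -/c -/d; ring.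
- rewrite absz_le_rat !natrM.
  apply: etrans (sum_bound1 hA hB m1 (hnum x1) (hden x1) (hnum x2) (hden x2)).
  by congr (`|_| <= _); rewrite /e_1 -/a -/b -/c -/d; ring.
rewrite absz_le_rat !natrM.
apply: etrans (sum_bound2 hA hB m1 (hnum x1) (hden x1) (hnum x2) (hden x2)).
by congr (`|_| <= _); rewrite /e_2 -/a -/b -/c -/d; ring.
Qed.

End CurveHeights.

(** * The canonical height *)

Lemma hgtE q : hgt q = ln (mht q)%:R.
Proof.
by rewrite /hgt -!natr_absz /mht natr_max.
Qed.

Lemma hxE P : hx P = ln (mhp P)%:R.
Proof. by case: P => [[x y]|] /=; rewrite ?hgtE ?ln1. Qed.

Lemma ln_natM (a b : nat) : (0 < a)%N -> (0 < b)%N ->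
  ln (a * b)%:R = ln a%:R + ln b%:R :> R.
Proof. by move=> a0 b0; rewrite natrM lnM // posrE ltr0n. Qed.

Lemma ln_natX (a n : nat) : (0 < a)%N -> ln (a ^ n)%:R = n%:R * ln a%:R :> R.
Proof. by move=> a0; rewrite natrX lnXn ?ltr0n // mulr_natl. Qed.

Lemma ler_ln_nat (a b : nat) : (0 < a)%N -> (a <= b)%N -> ln a%:R <= ln b%:R :> R.
Proof.
move=> a0 ab; rewrite ler_ln ?posrE ?ltr0n ?ler_nat //.
exact: leq_trans ab.
Qed.

Lemma hx_ge0 P : 0 <= hx P.
Proof. by rewrite hxE ln_ge0 // ler1n mhp_gt0. Qed.

Section CanonicalHeight.
Variables (C : curve rat) (A B : int) (m : nat).
Hypotheses (eA : cA C = A%:~R) (eB : cB C = B%:~R).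
Hypotheses (m_gt0 : (0 < m)%N) (Am : (`|A| <= m)%N) (Bm : (`|B| <= m)%N).

Definition hpt (P : curve_point C) : R := hx (cval P).
(** One error term for all estimates: [800 * m ^ 5] also dominates the factors [12 * m ^ 2] and
    [24 * m ^ 2]. *)
Definition hconst : R := ln (800 * m ^ 5)%:R.

Let c_gt0 : (0 < 800 * m ^ 5)%N.
Proof. by rewrite muln_gt0 expn_gt0 m_gt0. Qed.

Lemma hpt_ge0 P : 0 <= hpt P. Proof. exact: hx_ge0. Qed.

Lemma hpt_double P : `|hpt (P *+ 2) - 4 * hpt P| <= hconst.
Proof.
have p0 := mhp_gt0 P; have p20 := mhp_gt0 (P *+ 2)%R.
have h1 := mhp_double_ge eA eB m_gt0 Am Bm P.
have {}h1 := ler_ln_nat _ h1; rewrite ln_natX // ln_natM // in h1.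
have h2 := mhp_double_le eA eB m_gt0 Am Bm P.
have {}h2 : (mhp (P *+ 2)%R <= 800 * m ^ 5 * mhp P ^ 4)%N.
  apply: leq_trans h2 _; rewrite leq_mul2r; apply/orP; right.
  by apply: leq_mul => //; rewrite leq_pexp2l.
have {}h2 := ler_ln_nat p20 h2; rewrite ln_natM ?expn_gt0 ?p0 // ln_natX // in h2.
rewrite /hpt !hxE ler_distl /hconst; apply/andP; split.
  by have := h1 _; rewrite expn_gt0 p0 => /(_ isT); lra.
by lra.
Qed.

Lemma hpt_parallelogram P Q : hpt (P + Q) + hpt (P - Q) <= 2 * hpt P + 2 * hpt Q + hconst.
Proof.
have h := mhp_parallelogram eA eB m_gt0 Am Bm P Q.
have {}h : (mhp (P + Q)%R * mhp (P - Q)%R <= 800 * m ^ 5 * (mhp P ^ 2 * mhp Q ^ 2))%N.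
  apply: leq_trans h _; rewrite leq_mul2r; apply/orP; right.
  by apply: leq_mul => //; rewrite leq_pexp2l.
have pos : (0 < mhp (P + Q)%R * mhp (P - Q)%R)%N by rewrite muln_gt0 !mhp_gt0.
have p2 (S : curve_point C) : (0 < mhp S ^ 2)%N by rewrite expn_gt0 mhp_gt0.
have p22 : (0 < mhp P ^ 2 * mhp Q ^ 2)%N by rewrite muln_gt0 !p2.
have := ler_ln_nat pos h; rewrite (ln_natM (mhp_gt0 _) (mhp_gt0 _)).
rewrite (ln_natM c_gt0 p22) (ln_natM (p2 _) (p2 _)) !(ln_natX _ (mhp_gt0 _)).
by rewrite /hpt !hxE /hconst; lra.
Qed.

Definition canonical_height : curve_point C -> R := tate_limit hpt.

Lemma canonical_height_quadratic : quadratic canonical_height.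
Proof.
split; first exact: tate_ge0 hpt_ge0 hpt_double.
exact: tate_parallelogram hpt_ge0 hpt_double hpt_parallelogram.
Qed.

Lemma hconst_ge0 : 0 <= hconst.
Proof. exact: le_trans (normr_ge0 _) (hpt_double 0). Qed.

Lemma canonical_height_dist P : `|canonical_height P - hpt P| <= hconst.
Proof.
apply: le_trans (tate_dist hpt_ge0 hpt_double P) _.
by have := hconst_ge0; lra.
Qed.

End CanonicalHeight.

Lemma mht_to_short (E : wcoef) (beta : int) x y : 3 * b2 E = beta%:~R ->
  (mht (sX E (x, y)) <= (36 + `|beta|) * mht x)%N /\
  (mht x <= (36 + `|beta|) * mht (sX E (x, y)))%N.
Proof.
move=> eb; have eX : sX E (x, y) = 36 * x + beta%:~R by rewrite /sX -eb.
move: (sX E (x, y)) eX => X eX.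
have num := numqE.
have h (z : rat) : (`|numq z| <= mht z)%N /\ (`|denq z| <= mht z)%N by split; [exact: leq_maxl|exact: leq_maxr].
have tri (u v : int) a b : (`|u| <= a)%N -> (`|v| <= b)%N -> (`|(u + v)%R| <= a + b)%N.
  by lia.
have [nx dx] := h x; have [nX dX] := h X.
split.
  apply: leq_trans (mht_frac_le (denq_neq0 x) (m := 36 * numq x + beta * denq x) _) _.
    by rewrite rmorphD !rmorphM /= num eX; ring.
  rewrite geq_max mulnDl; apply/andP; split; last first.
    by apply: leq_trans dx _; rewrite -addnA leq_addr.
  by apply: tri; rewrite abszM leq_mul.
apply: leq_trans (mht_frac_le (n := 36 * denq X) (m := numq X - beta * denq X) _ _) _.
- by rewrite mulf_eq0 negb_or denq_neq0.
- rewrite rmorphB !rmorphM /= num; move: (denq X)%:~R => d.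
  by rewrite eX; ring.
rewrite geq_max mulnDl; apply/andP; split.
  apply: tri; first by apply: leq_trans nX _; rewrite leq_pmull.
  by rewrite abszN abszM leq_mul.
by rewrite abszM; apply: (@leq_trans (36 * mht X)%N); rewrite ?leq_addr // leq_mul2l.
Qed.

(** The substitution [X = 36 x + beta] moves the height by at most [ln (36 + |beta|)]. This depends
    on the curve but not on the point, so division by [4 ^ n] removes it. *)
Lemma hhatE (E : wcoef) (d0 : disc E != 0) (beta A B : int) (m : nat) P :
    3 * b2 E = beta%:~R ->
    cA (short_curve d0) = A%:~R -> cB (short_curve d0) = B%:~R ->
    (0 < m)%N -> (`|A| <= m)%N -> (`|B| <= m)%N -> on_curve E P ->
  hhat E P = canonical_height (spoint d0 P).
Proof.
move=> eb eA eB m0 Am Bm hP.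
pose c : R := ln (36 + `|beta|)%:R.
have c0 : (0 < 36 + `|beta|)%N by [].
have dist Q : on_curve E Q -> `|hx Q - hpt (spoint d0 Q)| <= c.
  move=> hQ; rewrite /hpt (spointE d0 hQ) !hxE; case: Q hQ => [[x y]|] _;
    cbv beta iota delta [mhp to_short]; last first.
    by rewrite subrr normr0; apply: ln_ge0; rewrite ler1n.
  have [h1 h2] := mht_to_short x y eb.
  move: (mht _) (mht (sX _ _)) (mht_gt0 x) (mht_gt0 (sX E (x, y))) h1 h2.
  move=> a b a0 b0 /(ler_ln_nat b0) h1 /(ler_ln_nat a0) h2.
  rewrite (ln_natM c0 a0) -/c in h1; rewrite (ln_natM c0 b0) -/c in h2.
  by rewrite ler_distl; apply/andP; split; lra.
apply: (cvg_lim (@Rhausdorff R)).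
pose b n := hpt (spoint d0 P *+ 2 ^ n).
apply: (@cvg_div4_dist R _ b c); last first.
  exact: (tate_cvg (@hpt_ge0 (short_curve d0)) (hpt_double eA eB m0 Am Bm)).
move=> n; have [on eq] := iter_dbl_spoint d0 n hP.
by rewrite /b -eq; exact: dist.
Qed.

(** * Integral points in one class modulo torsion *)

Definition odd_int (z : int) : bool := ~~ (2 %| z)%Z.

Lemma odd_int_double1 q : odd_int (2 * q + 1).
Proof. by rewrite /odd_int rpredDl ?dvdz_mulr. Qed.

Lemma odd_int_coprime o k : odd_int o -> coprimez (2 ^+ k) o.
Proof.
move=> ho; rewrite coprimezE abszX; apply: coprimeXl.
by rewrite prime_coprime // -(dvdzE 2).
Qed.

Lemma dvdz_cancel_odd o k (z : int) : odd_int o -> (2 ^+ k %| o * z)%Z = (2 ^+ k %| z)%Z.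
Proof. by move=> ho; rewrite Gauss_dvdzr // odd_int_coprime. Qed.

Lemma odd_intM x y : odd_int (x * y) = odd_int x && odd_int y.
Proof. by rewrite /odd_int dvdzE abszM Euclid_dvdM // negb_or -!dvdzE. Qed.

Lemma dvdz_exp2 (k l : nat) (z : int) : (k <= l)%N -> (2 ^+ l %| z)%Z -> (2 ^+ k %| z)%Z.
Proof. by move=> kl; apply: dvdz_trans; rewrite dvdz_exp2l. Qed.

Lemma dvdz_cancel2 D k (o tau z : int) : odd_int o -> odd_int tau ->
  (2 ^+ (D + k) %| 2 ^+ D * o * tau * z)%Z -> (2 ^+ k %| z)%Z.
Proof.
move=> ho ht; rewrite exprD -!mulrA dvdz_mul2l ?expf_neq0 // => h.
by rewrite -(@dvdz_cancel_odd tau) // -(@dvdz_cancel_odd o).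
Qed.

(* Divided differences of [x^3 + A x + B] through four points whose values are
   squares of multiples of a high power of 2. *)
Lemma four_classes_divisible (x0 x1 x2 x3 y0 y1 y2 y3 A B o t0 t1 t2 t3 : int) (D : nat) :
    odd_int o ->
    odd_int (t1 - t0) -> odd_int (t3 - t0) -> odd_int (t2 - t1) -> odd_int (t3 - t2) ->
    (exists2 t, odd_int t & t2 - t0 = 2 * t) -> (exists2 t, odd_int t & t3 - t1 = 2 * t) ->
    x1 - x0 = 2 ^+ D * o * (t1 - t0) -> x2 - x0 = 2 ^+ D * o * (t2 - t0) ->
    x3 - x0 = 2 ^+ D * o * (t3 - t0) ->
    (forall y, y \in [:: y0; y1; y2; y3] -> (2 ^+ (D + 3) %| y)%Z) ->
    y0 ^+ 2 = x0 ^+ 3 + A * x0 + B -> y1 ^+ 2 = x1 ^+ 3 + A * x1 + B ->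
    y2 ^+ 2 = x2 ^+ 3 + A * x2 + B -> y3 ^+ 2 = x3 ^+ 3 + A * x3 + B ->
  (2 ^+ 8 %| A)%Z /\ (2 ^+ 12 %| B)%Z.
Proof.
move=> ho o10 o30 o21 o32 [u ou eu] [v ov ev] d1 d2 d3 hy e0 e1 e2 e3.
have sq y : y \in [:: y0; y1; y2; y3] -> (2 ^+ (D + (D + 6)) %| y ^+ 2)%Z.
  move=> /hy h; have -> : (D + (D + 6) = (D + 3) * 2)%N by clear; lia.
  by rewrite exprM; apply: dvdz_exp2r.
have s0 : (2 ^+ (D + (D + 6)) %| y0 ^+ 2)%Z by rewrite sq ?inE ?eqxx.
have s1 : (2 ^+ (D + (D + 6)) %| y1 ^+ 2)%Z by rewrite sq ?inE ?eqxx ?orbT.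
have s2 : (2 ^+ (D + (D + 6)) %| y2 ^+ 2)%Z by rewrite sq ?inE ?eqxx ?orbT.
have s3 : (2 ^+ (D + (D + 6)) %| y3 ^+ 2)%Z by rewrite sq ?inE ?eqxx ?orbT.
(* The first divided difference at [x0] and [x]. Passing to it costs [D] powers of 2, and one more
   for [x2], whose index difference is exactly twice an odd number. *)
pose f x := x0 ^+ 2 + x0 * x + x ^+ 2 + A.
have f1 : (2 ^+ (D + 6) %| f x1)%Z.
  apply: (dvdz_cancel2 (D := D) ho o10); rewrite -d1.
  have -> : (x1 - x0) * f x1 = y1 ^+ 2 - y0 ^+ 2 by rewrite e0 e1 /f; ring.
  by rewrite rpredB.
have f3 : (2 ^+ (D + 6) %| f x3)%Z.
  apply: (dvdz_cancel2 (D := D) ho o30); rewrite -d3.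
  have -> : (x3 - x0) * f x3 = y3 ^+ 2 - y0 ^+ 2 by rewrite e0 e3 /f; ring.
  by rewrite rpredB.
have f2 : (2 ^+ (D + 5) %| f x2)%Z.
  apply: (dvdz_cancel2 (D := D.+1) ho ou).
  have -> : 2 ^+ D.+1 * o * u * f x2 = (x2 - x0) * f x2.
    by rewrite d2 eu exprS; ring.
  have -> : (x2 - x0) * f x2 = y2 ^+ 2 - y0 ^+ 2 by rewrite e0 e2 /f; ring.
  have -> : (D.+1 + (D + 5) = D + (D + 6))%N by clear; lia.
  by rewrite rpredB.
(* The second divided differences of the cubic are sums of three abscissas. *)
have g2 : (2 ^+ 5 %| x0 + x1 + x2)%Z.
  apply: (dvdz_cancel2 (D := D) ho o21).
  have -> : 2 ^+ D * o * (t2 - t1) * (x0 + x1 + x2) = f x2 - f x1.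
    have -> : 2 ^+ D * o * (t2 - t1) = x2 - x1.
      have -> : x2 - x1 = (x2 - x0) - (x1 - x0) by ring.
      by rewrite d1 d2; ring.
    by rewrite /f; ring.
  by rewrite rpredB // (dvdz_exp2 _ f1) // leq_add2l.
have g3 : (2 ^+ 5 %| x0 + x1 + x3)%Z.
  apply: (dvdz_cancel2 (D := D.+1) ho ov).
  have -> : 2 ^+ D.+1 * o * v * (x0 + x1 + x3) = f x3 - f x1.
    have -> : 2 ^+ D.+1 * o * v = x3 - x1.
      have -> : x3 - x1 = (x3 - x0) - (x1 - x0) by ring.
      by rewrite d1 d3 exprS -mulrBr opprB addrA subrK ev; ring.
    by rewrite /f; ring.
  have -> : (D.+1 + 5 = D + 6)%N by clear; lia.
  by rewrite rpredB.
have e32 : x3 - x2 = 2 ^+ D * o * (t3 - t2).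
  have -> : x3 - x2 = (x3 - x0) - (x2 - x0) by ring.
  by rewrite d2 d3; ring.
(* [x3 - x2] is the difference of the two sums just treated, yet [2 ^ D] is the exact power of 2 in
   it. *)
have D5 : (5 <= D)%N.
  rewrite leqNgt; apply/negP => lt.
  have : (2 ^+ 5 %| 2 ^+ D * (o * (t3 - t2)))%Z.
    rewrite mulrA -e32; have -> : x3 - x2 = (x0 + x1 + x3) - (x0 + x1 + x2) by ring.
    by rewrite rpredB.
  rewrite -(subnKC (ltnW lt)).
  rewrite exprD dvdz_mul2l ?expf_neq0 // => h.
  have : odd_int (o * (t3 - t2)) by rewrite odd_intM ho.
  by rewrite /odd_int -[2 in X in X -> _]expr1 (dvdz_exp2 _ h) // subn_gt0.
have dD (z : int) : (2 ^+ 5 %| 2 ^+ D * z)%Z by apply: dvdz_mulr; exact: dvdz_exp2l.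
have h0 : (2 ^+ 5 %| x0)%Z.
  rewrite -(@dvdz_cancel_odd 3) //.
  have -> : 3 * x0 = (x0 + x1 + x2) - (x1 - x0) - (x2 - x0) by ring.
  rewrite d1 d2 -!mulrA; apply: rpredB (dD _); exact: rpredB (dD _).
have h1 : (2 ^+ 5 %| x1)%Z.
  by rewrite -[x1](subrK x0) rpredD // d1 -mulrA dD.
have p2 x y : (2 ^+ 5 %| x)%Z -> (2 ^+ 5 %| y)%Z -> (2 ^+ 10 %| x * y)%Z.
  by move=> hx hy'; rewrite -[10%N]/(5 + 5)%N exprD dvdz_mul.
have hA : (2 ^+ 10 %| A)%Z.
  have -> : A = f x1 - x0 * x0 - x0 * x1 - x1 * x1 by rewrite /f; ring.
  rewrite !rpredB ?p2 //; apply: dvdz_exp2 f1; clear - D5; lia.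
split; first exact: dvdz_exp2 hA.
have -> : B = y0 ^+ 2 - x0 * x0 * x0 - A * x0 by rewrite e0; ring.
apply: (@dvdz_exp2 12 15) => //; rewrite !rpredB //.
- by apply: dvdz_exp2 s0; clear - D5; lia.
- by rewrite -[15%N]/(10 + 5)%N exprD dvdz_mul // p2.
- by rewrite -[15%N]/(10 + 5)%N exprD dvdz_mul.
Qed.

Lemma two_part (d : int) : d != 0 -> exists e o, odd_int o /\ d = 2 ^+ e * o.
Proof.
move=> d0; have d0' : (0 < `|d|)%N by rewrite absz_gt0.
have [m cm em] := pfactor_coprime (isT : prime 2) d0'.
exists (logn 2 `|d|), (sgz d * m%:Z); split.
  rewrite odd_intM /odd_int; apply/andP; split; last by rewrite dvdzE -prime_coprime.
  by case: sgzP d0.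
rewrite mulrCA [LHS]intEsg; congr (_ * _); rewrite [in LHS]em PoszM mulrC; congr (_ * _).
by rewrite -[LHS]natz natrX.
Qed.

Lemma leq_sum_class (F : nat) (r0 : 'I_4) :
  (\sum_(t < 16) (if t %% 4 == r0 then 2 else F) = 8 + 12 * F)%N.
Proof.
by case: r0 => [[|[|[|[|//]]]] h]; rewrite !big_ord_recl big_ord0 /=; lia.
Qed.

Section Tree.
Variables (X Y : nat -> int) (a d A B : int) (n : nat) (I : {set 'I_(16 ^ n)}).
Hypotheses (d0 : d != 0) (eX : forall i : 'I_(16 ^ n), i \in I -> X i = a + i%:Z * d).
Hypothesis eY : forall i : 'I_(16 ^ n), i \in I -> Y i ^+ 2 = X i ^+ 3 + A * X i + B.
Hypothesis compat : forall i j : 'I_(16 ^ n), i \in I -> j \in I -> i != j ->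
  forall e, (2 ^+ e %| X i - X j)%Z -> (2 ^+ e %| Y i + Y j)%Z.
Hypothesis nAB : ~ ((2 ^+ 8 %| A)%Z /\ (2 ^+ 12 %| B)%Z).

(** The node at depth [c] whose low digits form [rho]; its children are the
    [J c.+1 (rho + 16 ^ c * t)]. *)
Let J c rho : {set 'I_(16 ^ n)} := [set i in I | (i %% 16 ^ c == rho)%N].
Let digit c (i : nat) : 'I_16 := inord (i %/ 16 ^ c %% 16)%N.

Let digitE c i : digit c i = (i %/ 16 ^ c %% 16)%N :> nat.
Proof. by rewrite /digit inordK // ltn_pmod. Qed.

Let JS c rho i : i \in J c rho -> (i %% 16 ^ c.+1 = rho + 16 ^ c * digit c i)%N.
Proof.
rewrite inE => /andP[_ /eqP <-]; rewrite digitE.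
have p0 : (0 < 16 ^ c)%N by rewrite expn_gt0.
have lt : (i %% 16 ^ c + 16 ^ c * (i %/ 16 ^ c %% 16) < 16 ^ c.+1)%N.
  have := ltn_pmod i p0; have := ltn_pmod (i %/ 16 ^ c) (isT : 0 < 16)%N.
  by rewrite expnS; move: (16 ^ c)%N (_ %/ _ %% 16)%N (i %% _)%N => w u v; clear; nia.
rewrite -[RHS](modn_small lt) -[RHS](modnMDl (i %/ 16 ^ c %/ 16)); congr (_ %% _)%N.
rewrite {1}(divn_eq i (16 ^ c)) {1}(divn_eq (i %/ 16 ^ c) 16) expnS.
by move: (16 ^ c)%N (_ %/ 16)%N (_ %% 16)%N (i %% _)%N => z u v w; clear; lia.
Qed.

Let big_child c rho (t : 'I_16) := (2 < #|[set i in J c rho | digit c i == t]|)%N.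

(* [2 Y i] is an integral combination of the pairwise sums of [Y] over three
   members of the child, which are divisible by [2 ^ (e + 4)]. *)
Let big_child_div c rho t e o : odd_int o -> d * (16 ^ c)%N%:Z = 2 ^+ e * o ->
    big_child c rho t ->
  exists i : 'I_(16 ^ n), [/\ i \in J c rho, digit c i = t & (2 ^+ (e + 3) %| Y i)%Z].
Proof.
move=> ho ed /card_gt2P[i [j [k [[hi hj hk] [nij njk nki]]]]].
exists i; move: hi hj hk; rewrite !inE => /andP[/andP[iI /eqP im] /eqP it].
move=> /andP[/andP[jI /eqP jm] /eqP jt] /andP[/andP[kI /eqP km] /eqP kt].
split=> //; first by rewrite iI im eqxx.
(* Indices in one child differ by a multiple of [16 ^ (c + 1)], which gives four powers of 2 beyond
   those of [d * 16 ^ c]. *)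
have dX (u v : 'I_(16 ^ n)) : u \in I -> v \in I -> (u %% 16 ^ c)%N = rho -> (v %% 16 ^ c)%N = rho ->
    digit c u = t -> digit c v = t -> (2 ^+ (e + 4) %| X u - X v)%Z.
  move=> uI vI um vm ut vt.
  have hu : u \in J c rho by rewrite inE uI um eqxx.
  have hv : v \in J c rho by rewrite inE vI vm eqxx.
  have := JS hu; have := JS hv; rewrite ut vt => mv mu.
  have -> : X u - X v = (d * (16 ^ c)%N%:Z) * (16 * ((u %/ 16 ^ c.+1)%N%:Z - (v %/ 16 ^ c.+1)%N%:Z)).
    have z (w : nat) : (w %% 16 ^ c.+1 = rho + 16 ^ c * t)%N ->
        w%:Z = 16 * (16 ^ c)%N%:Z * (w %/ 16 ^ c.+1)%N%:Z + (rho + 16 ^ c * t)%N%:Z.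
      move=> wm; rewrite {1}(divn_eq w (16 ^ c.+1)) wm PoszD PoszM [in RHS]mulrC.
      by rewrite [in X in _ * X + _]expnS PoszM.
    by rewrite !eX // (z _ mu) (z _ mv); ring.
  rewrite ed exprD -!mulrA; apply: dvdz_mul => //.
  by rewrite mulrCA; apply: dvdz_mulr; rewrite (_ : 2 ^+ 4 = 16).
have s1 := compat iI jI nij (dX _ _ iI jI im jm it jt).
have s2 := compat iI kI _ (dX _ _ iI kI im km it kt).
have s3 := compat jI kI njk (dX _ _ jI kI jm km jt kt).
have : (2 ^+ (e + 4) %| 2 * Y i)%Z.
  have -> : 2 * Y i = (Y i + Y j) + (Y i + Y k) - (Y j + Y k) by ring.
  by rewrite rpredB // rpredD // s2 // eq_sym.
by rewrite addnS exprS dvdz_mul2l.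
Qed.

Let no_four_classes c rho : (rho < 16 ^ c)%N ->
  exists r0 : 'I_4, forall t : 'I_16, big_child c rho t -> (t %% 4 != r0)%N.
Proof.
move=> hrho.
have [/existsP[r0 /forallP h]|] :=
  boolP [exists r0 : 'I_4, forall t : 'I_16, big_child c rho t ==> (t %% 4 != r0)%N].
  by exists r0 => t; exact/implyP.
rewrite negb_exists => /forallP h; exfalso.
have [e0 [w1 [ho ed]]] := two_part d0.
have ed' : d * (16 ^ c)%N%:Z = 2 ^+ (e0 + 4 * c) * w1.
  by rewrite ed exprD exprM -[(16 ^ c)%N%:Z]natz natrX mulrAC.
(* One point from a big child in each residue class; the multipliers [4 q + r] have odd differences
   for neighbouring classes and twice odd ones for opposite classes. *)
have H (r : nat) : (r < 4)%N -> exists (i : 'I_(16 ^ n)) (q : int),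
    [/\ i \in I, i%:Z = rho%:Z + (16 ^ c)%N%:Z * (4 * q + r%:Z)
      & (2 ^+ (e0 + 4 * c + 3) %| Y i)%Z].
  move=> r4; have := h (Ordinal r4); rewrite negb_forall => /existsP[t].
  rewrite negb_imply negbK => /andP[bt /eqP e].
  have [i [iJ it iY]] := big_child_div ho ed' bt.
  have iJ' := iJ; rewrite inE in iJ'; case/andP: iJ' => iI /eqP im.
  exists i, (i %/ 16 ^ c %/ 4)%N; split=> //.
  have mr : (i %/ 16 ^ c %% 4 = r)%N.
    by rewrite -[r]e -it digitE modn_dvdm.
  rewrite {1}(divn_eq i (16 ^ c)) im {1}(divn_eq (i %/ 16 ^ c) 4) mr.
  by rewrite !PoszD !PoszM PoszD PoszM; ring.
have [i0 [q0 [I0 p0 y0]]] := H 0%N isT; have [i1 [q1 [I1 p1 y1]]] := H 1%N isT.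
have [i2 [q2 [I2 p2 y2]]] := H 2%N isT; have [i3 [q3 [I3 p3 y3]]] := H 3%N isT.
have od z q : z = 2 * q + 1 -> odd_int z by move=> ->; exact: odd_int_double1.
have df (i j : 'I_(16 ^ n)) (u v : int) : i \in I -> j \in I ->
    i%:Z = rho%:Z + (16 ^ c)%N%:Z * u -> j%:Z = rho%:Z + (16 ^ c)%N%:Z * v ->
    X i - X j = 2 ^+ (e0 + 4 * c) * w1 * (u - v).
  by move=> iI jI eu ev; rewrite -ed' !eX // eu ev; ring.
apply: nAB; apply: (four_classes_divisible (D := e0 + 4 * c) (t0 := 4 * q0 + 0%N%:Z)
  (t1 := 4 * q1 + 1%N%:Z) (t2 := 4 * q2 + 2%N%:Z) (t3 := 4 * q3 + 3%N%:Z) ho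
  _ _ _ _ _ _ (df _ _ _ _ I1 I0 p1 p0) (df _ _ _ _ I2 I0 p2 p0) (df _ _ _ _ I3 I0 p3 p0)
  _ (eY I0) (eY I1) (eY I2) (eY I3)).
- by apply: (od _ (2 * q1 - 2 * q0)); ring.
- by apply: (od _ (2 * q3 - 2 * q0 + 1)); ring.
- by apply: (od _ (2 * q2 - 2 * q1)); ring.
- by apply: (od _ (2 * q3 - 2 * q2)); ring.
- exists (2 * (q2 - q0) + 1); last by ring.
  by apply: (od _ (q2 - q0)).
- exists (2 * (q3 - q1) + 1); last by ring.
  by apply: (od _ (q3 - q1)).
by move=> y; rewrite !inE => /or4P[] /eqP ->.
Qed.

(** At each node the four children in the missing class hold at most two points each, and [8 + 12 *
    (4 * 14 ^ k) <= 4 * 14 ^ (k + 1)], with equality at [k = 0]. *)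
Lemma tree_card : (#|I| <= 4 * 14 ^ n)%N.
Proof.
suff bound k c rho : (c + k = n)%N -> (#|J c rho| <= 4 * 14 ^ k)%N.
  have := bound n 0%N 0%N (erefl _); apply: leq_trans; apply: subset_leq_card.
  by apply/fintype.subsetP => i iI; rewrite inE iI expn0 modn1.
elim: k c rho => [|k IH] c rho eck.
  apply: (@leq_trans 1) => //; apply/fintype.card_le1_eqP => i j; rewrite !inE.
  move=> /andP[_ /eqP im] /andP[_ /eqP jm]; apply: val_inj => /=.
  by move: im jm; rewrite -(addn0 c) eck !modn_small ?ltn_ord // => -> ->.
have [rlt|rge] := ltnP rho (16 ^ c); last first.
  rewrite (_ : J c rho = finset.set0) ?cards0 //; apply/finset.setP => i; rewrite !inE.
  apply/negbTE; rewrite negb_and; apply/orP; right.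
  by rewrite neq_ltn (leq_trans _ rge) // ltn_pmod // expn_gt0.
have [r0 hr0] := no_four_classes rlt.
have -> : #|J c rho| = (\sum_(t < 16) #|[set i in J c rho | digit c i == t]|)%N.
  rewrite -sum1_card (partition_big (fun i : 'I_(16 ^ n) => digit c i) predT) //=.
  by apply: eq_bigr => t _; rewrite -sum1_card; apply: eq_bigl => i; rewrite !inE.
apply: (@leq_trans (8 + 12 * (4 * 14 ^ k))%N); last first.
  by rewrite expnS; have : (0 < 14 ^ k)%N; [rewrite expn_gt0|lia].
rewrite -(leq_sum_class _ r0); apply: leq_sum => t _; case: ifP => ht.
  rewrite leqNgt; apply/negP => /hr0; by rewrite ht.
apply: leq_trans (IH c.+1 (rho + 16 ^ c * t)%N _); last by rewrite addSnnS.
apply: subset_leq_card; apply/fintype.subsetP => i; rewrite inE => /andP[hi /eqP it].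
have := JS hi; rewrite it inE => ->; rewrite eqxx andbT.
by move: hi; rewrite inE => /andP[].
Qed.

End Tree.

(** * Minimality at 2 *)

Lemma int_parity (z : int) : exists k : int, z = 2 * k \/ z = 2 * k + 1.
Proof. by exists (z %/ 2)%Z; lia. Qed.

(* The coefficients on the right are those of the equation obtained with
   [u = 2], [s = - al], [r = 5 be] and [t = - ga]. *)
Lemma nonminimal_at_2 (a1 a2 a3 a4 a6 w w' : int) :
    let b2 := a1 ^+ 2 + 4 * a2 in let b4 := 2 * a4 + a1 * a3 in
    let b6 := a3 ^+ 2 + 4 * a6 in
    b2 ^+ 2 - 24 * b4 = 256 * w ->
    - b2 ^+ 3 + 36 * b2 * b4 - 216 * b6 = 2048 * w' ->
  exists al be ga b k : int,
    let r := 5 * be in let s := - al in let t := - ga in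
    [/\ a1 + 2 * s = 0, a2 - s * a1 + 3 * r - s ^+ 2 = 16 * be,
        a3 + r * a1 + 2 * t = 0,
        a4 - s * a3 + 2 * r * a2 - (t + r * s) * a1 + 3 * r ^+ 2 - 2 * s * t = 16 * b &
        a6 + r * a4 + r ^+ 2 * a2 + r ^+ 3 - t * a3 - t ^+ 2 - r * t * a1 = 64 * k].
Proof.
move=> b2 b4 b6 h4 h6.
have [al [e1|e1]] := int_parity a1; last first.
  exfalso; move: h4; rewrite /b2 e1.
  have -> : ((2 * al + 1) ^+ 2 + 4 * a2) ^+ 2 - 24 * b4 =
    2 * (8 * (al ^+ 2 + al + a2) ^+ 2 + 4 * (al ^+ 2 + al + a2) - 12 * b4) + 1 by ring.
  by move: (8 * _ + _ - _) => z; clear; lia.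
(* Here [b2 = 4 be], and the translation by [5 be] makes the new second coefficient
   [be + 15 be = 16 be]; [x] is the new fourth coefficient. *)
pose be := a2 + al ^+ 2; pose x := a4 + al * a3 + 85 * be ^+ 2.
pose y := 16 * be ^+ 2 - w; pose b := x - 5 * y.
have h3x : 3 * x = 16 * y.
  have : 16 * (3 * x) = 16 * (16 * y).
    have -> : 16 * (16 * y) = 4096 * be ^+ 2 - 256 * w by rewrite /y; ring.
    by rewrite -h4 /b2 /b4 /x /be e1; ring.
  by move: (3 * x) (16 * y); clear; lia.
have ex : x = 16 * b by rewrite /b; move: (x) (y) h3x; clear; lia.
pose g := a3 + 5 * be * a1; pose h := a6 + 5 * be * a4 + (5 * be) ^+ 2 * a2 + (5 * be) ^+ 3.
pose v := - 128 * be ^+ 3 + 36 * be * b - w'.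
have h27 : 27 * (g ^+ 2 + 4 * h) = 256 * v.
  have : 8 * (27 * (g ^+ 2 + 4 * h)) = 8 * (256 * v).
    have -> : 8 * (256 * v) = - 64 ^+ 3 * be ^+ 3 + 36 * (64 * be) * (2 * (16 * b)) - 2048 * w'.
      by rewrite /v; ring.
    by rewrite -h6 -ex /x /b2 /b4 /b6 /g /h /be e1; ring.
  by move: (27 * _) (256 * v); clear; lia.
(* 27 is inverted modulo 256 through [27 * 19 = 2 * 256 + 1]. *)
have eg : g ^+ 2 + 4 * h = 256 * (19 * v - 2 * (g ^+ 2 + 4 * h)).
  by move: (g ^+ 2 + 4 * h) (v) h27; clear; lia.
move: (19 * v - _) eg => k eg.
have [ga [e|e]] := int_parity g; last first.
  exfalso; move: eg; rewrite e.
  have -> : (2 * ga + 1) ^+ 2 + 4 * h = 2 * (2 * (ga ^+ 2 + ga + h)) + 1 by ring.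
  by move: (2 * (_ + _)) => z; clear; lia.
exists al, be, ga, b, k; split.
- by rewrite e1; ring.
- by rewrite e1 /be; ring.
- by rewrite -/g e; ring.
- rewrite -ex /x.
  have -> : a3 = 2 * ga - 5 * be * a1 by rewrite -e /g; ring.
  have -> : a2 = be - al ^+ 2 by rewrite /be; ring.
  by rewrite e1; ring.
have -> : 64 * k = h + ga ^+ 2.
  move: eg; rewrite e; have -> : (2 * ga) ^+ 2 = 4 * ga ^+ 2 by ring.
  by move: (ga ^+ 2) (h) (k); clear; lia.
have -> : a3 = 2 * ga - 5 * be * a1 by rewrite -e /g; ring.
by rewrite /h; ring.
Qed.

Lemma c4_change E u r s t : u != 0 -> c4 (change E u r s t) = c4 E / u ^+ 4.
Proof.
move: E => [a1 a2 a3 a4 a6] u0; rewrite /c4 /b2 /b4.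
cbv beta iota delta [change Defs.a1 Defs.a2 Defs.a3 Defs.a4 Defs.a6].
by field; rewrite u0.
Qed.

Lemma c6_change E u r s t : u != 0 -> c6 (change E u r s t) = c6 E / u ^+ 6.
Proof.
move: E => [a1 a2 a3 a4 a6] u0; rewrite /c6 /b2 /b4 /b6.
cbv beta iota delta [change Defs.a1 Defs.a2 Defs.a3 Defs.a4 Defs.a6].
by field; rewrite u0.
Qed.

Lemma discE E : disc E = (c4 E ^+ 3 - c6 E ^+ 2) / 1728.
Proof. by rewrite c4_c6_disc mulrC mulKf ?pnatr_eq0. Qed.

Lemma disc_change E u r s t : u != 0 -> disc (change E u r s t) = disc E / u ^+ 12.
Proof.
move=> u0; rewrite !discE (c4_change _ _ _ _ u0) (c6_change _ _ _ _ u0).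
by move: (c4 E) (c6 E) (1728^-1) => x y c; field; rewrite u0.
Qed.

Lemma integral_modelE (x1 x2 x3 x4 x6 : rat) : integral_model (WCoef x1 x2 x3 x4 x6) =
  [&& x1 \is a Num.int, x2 \is a Num.int, x3 \is a Num.int, x4 \is a Num.int
    & x6 \is a Num.int].
Proof. by rewrite /integral_model /= andbT. Qed.

(** At 2, divisibility of [c4] by [2 ^ 4] and of [c6] by [2 ^ 6] does not guarantee a smaller
    integral model. The stronger [2 ^ 8] and [2 ^ 11] available here make the explicit change with
    [u = 2] integral, which divides the discriminant by [2 ^ 12]. *)
Lemma minimal_not_divisible (E : wcoef) (A B : int) : global_minimal E ->
    - 27 * c4 E = A%:~R -> - 54 * c6 E = B%:~R ->
  ~ ((2 ^+ 8 %| A)%Z /\ (2 ^+ 12 %| B)%Z).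
Proof.
move=> [int_E d0 minE] eA eB [/dvdzP[u eu] /dvdzP[v ev]].
move: int_E; rewrite /integral_model /= !andbT.
case/and5P=> /intrP[x1 e1] /intrP[x2 e2] /intrP[x3 e3] /intrP[x4 e4] /intrP[x6 e6].
pose B2 := x1 ^+ 2 + 4 * x2; pose B4 := 2 * x4 + x1 * x3; pose B6 := x3 ^+ 2 + 4 * x6.
pose z4 := B2 ^+ 2 - 24 * B4; pose z6 := - B2 ^+ 3 + 36 * B2 * B4 - 216 * B6.
have ez4 : c4 E = z4%:~R by rewrite /c4 /b2 /b4 e1 e2 e3 e4 /z4 /B2 /B4; ring.
have ez6 : c6 E = z6%:~R by rewrite /c6 /b2 /b4 /b6 e1 e2 e3 e4 e6 /z6 /B2 /B4 /B6; ring.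
have {}eu : A = 256 * u by rewrite eu; ring.
have {}ev : B = 4096 * v by rewrite ev; ring.
have h4 : - 27 * z4 = 256 * u by apply: (@intr_inj rat); rewrite -eu -eA ez4; ring.
have h6 : - 54 * z6 = 4096 * v by apply: (@intr_inj rat); rewrite -ev -eB ez6; ring.
(* The witnesses here and for [w'] come from [27 * 19 = 2 * 256 + 1] and
   [27 * 531 = 7 * 2048 + 1]. *)
have [w ew] : exists w, z4 = 256 * w.
  by exists (- 19 * u - 2 * z4); move: (z4) h4; clear; lia.
have [w' ew'] : exists w', z6 = 2048 * w'.
  by exists (- 531 * v - 7 * z6); move: (z6) h6; clear; lia.
have [al [be [ga [b [k [i1 i2 i3 i4 i6]]]]]] := nonminimal_at_2 ew ew'.
pose r : rat := (5 * be)%:~R; pose s : rat := (- al)%:~R; pose t : rat := (- ga)%:~R.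
have u2 : (2 : rat) != 0 by rewrite pnatr_eq0.
have := minE 2 r s t u2; rewrite (disc_change _ _ _ _ u2).
have -> : integral_model (change E 2 r s t).
  have q (x : int) (y z : rat) n : y = (2 ^+ n * x)%:~R -> z = 2 ^+ n ->
      y / z \is a Num.int.
    move=> -> ->; have n0 : (2 : rat) ^+ n != 0 by exact: expf_neq0.
    have -> : (2 ^+ n * x)%:~R = 2 ^+ n * x%:~R :> rat by rewrite intrM rmorphXn.
    by rewrite mulrC (mulKf n0) intr_int.
  rewrite /change integral_modelE; apply/and5P; split.
  - refine (q 0 _ _ 1%N _ _); last by rewrite expr1.
    by rewrite mulr0 -i1 e1 /s; ring.
  - refine (q (4 * be) _ _ 2%N _ (erefl _)).
    transitivity ((16 * be)%:~R : rat); last by congr (intr _); ring.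
    by rewrite -i2 e1 e2 /s /r; ring.
  - refine (q 0 _ _ 3%N _ (erefl _)).
    by rewrite mulr0 -i3 e1 e3 /r /t; ring.
  - refine (q b _ _ 4%N _ (erefl _)).
    transitivity ((16 * b)%:~R : rat); last by congr (intr _); ring.
    by rewrite -i4 e1 e2 e3 e4 /s /r /t; ring.
  - refine (q k _ _ 6%N _ (erefl _)).
    transitivity ((64 * k)%:~R : rat); last by congr (intr _); ring.
    by rewrite -i6 e1 e2 e3 e4 e6 /s /r /t; ring.
move=> /(_ isT); rewrite normrM leNgt => /negP; apply.
rewrite -[X in _ < X]mulr1 ltr_pM2l; last by rewrite normr_gt0.
rewrite normfV.
have p12 : 1 < (2 : rat) ^+ 12 by apply: exprn_egt1; rewrite ?ltr1n.
have p0 := lt_trans ltr01 p12.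
by rewrite (gtr0_norm p0) (invf_lt1 p0).
Qed.

(** * Bounds in terms of the heights of j and of the discriminant *)

Definition jdisc_height (E : wcoef) : R := Num.max (hgt (jinv E)) (hgt (disc E)).

Lemma absz_sqr_ge (z : int) : (`|z| <= `|(z ^+ 2)%R|)%N.
Proof. by rewrite abszX; case: (absz z) => // n; rewrite leq_pmulr. Qed.

(** Otherwise [z6 ^ 2] would lie within 1 of 1728, strictly between [41 ^ 2 = 1681] and
    [42 ^ 2 = 1764]. This excludes height 0 for both [j] and the discriminant, whence
    [ln 2 <= H]. *)
Lemma c6_not_square (z4 z6 D : int) : z4 ^+ 3 - z6 ^+ 2 = 1728 * D ->
  (`|(z4 ^+ 3)%R| <= 1)%N -> (`|D| <= 1)%N -> D = 0.
Proof.
rewrite -[z6 ^+ 2]gez0_abs ?sqr_ge0 // abszX; move: (z4 ^+ 3) => w.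
move: `|z6|%N => n e hw hD; apply/eqP/negPn/negP => D0.
have : (1727 <= n ^ 2 <= 1729)%N.
  by apply/andP; split; lia.
have [n41|n41] := leqP n 41.
  have : (n ^ 2 <= 41 ^ 2)%N by rewrite leq_exp2r.
  by move: (n ^ 2)%N => q; lia.
have : (42 ^ 2 <= n ^ 2)%N by rewrite leq_exp2r.
by move: (n ^ 2)%N => q; lia.
Qed.

Lemma mht_int (z : int) : (`|z| <= mht z%:~R)%N.
Proof. by rewrite /mht numq_int leq_maxl. Qed.

(** Since [j D = c4 ^ 3], the cube is at most [T |D|]; then [c6 ^ 2 = c4 ^ 3 - 1728 D] gives
    [1729 T S], and [27 + 54 * 1729 + 1 < 2 ^ 17]. *)
Lemma short_model_bound (E : wcoef) (z4 z6 D : int) : D != 0 ->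
    c4 E = z4%:~R -> c6 E = z6%:~R -> disc E = D%:~R ->
    z4 ^+ 3 - z6 ^+ 2 = 1728 * D ->
    let T := mht (jinv E) in let S := mht (disc E) in
  (27 * `|z4| + 54 * `|z6| + 1 <= 2 ^ 17 * (T * S))%N /\ (2 <= maxn T S)%N.
Proof.
move=> D0 e4 e6 eD e T S.
have T0 : (0 < T)%N := mht_gt0 _; have S0 : (0 < S)%N := mht_gt0 _.
have hD : (`|D| <= S)%N by rewrite /S eD mht_int.
have h3 : (`|(z4 ^+ 3)%R| <= T * `|D|)%N.
  have : jinv E * D%:~R = (z4 ^+ 3)%:~R.
    by rewrite /jinv eD divfK ?intr_eq0 // e4 rmorphXn.
  move=> /frac_multiple[k [-> eDk]]; rewrite abszM mulnC.
  apply: leq_mul; first exact: leq_maxl.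
  rewrite [in X in (_ <= X)%N]eDk abszM leq_pmulr // absz_gt0 denq_eq0 //.
have h3' : (`|(z4 ^+ 3)%R| <= T * S)%N by apply: leq_trans h3 _; rewrite leq_mul2l hD orbT.
have hS : (S <= T * S)%N by rewrite leq_pmull.
have P0 : (0 < T * S)%N by rewrite muln_gt0 T0.
split; last first.
  rewrite leq_max; apply/orP; move: T0 S0; case: (ltnP 1 T) => [|T1]; first by left.
  case: (ltnP 1 S) => [|S1]; first by right.
  move=> T0 S0; exfalso; have eT : T = 1%N by lia.
  have eS : S = 1%N by lia.
  move/eqP: D0; apply; apply: (c6_not_square e).
    by rewrite eT eS in h3'.
  by rewrite eS in hD.
have a4 : (`|z4| <= T * S)%N.
  apply: leq_trans h3'; rewrite abszX; case: (absz z4) => // n.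
  by rewrite expnS leq_pmulr // expn_gt0.
have a6 : (`|z6| <= 1729 * (T * S))%N.
  apply: leq_trans (absz_sqr_ge _) _.
  have -> : z6 ^+ 2 = z4 ^+ 3 - 1728 * D by rewrite -e; ring.
  have := leq_trans hD hS; move: (z4 ^+ 3) h3'; move: (T * S)%N.
  by clear; lia.
move: (T * S)%N a4 a6 P0 => P; move: `|z4|%N `|z6|%N => u v.
by rewrite (_ : 2 ^ 17 = 2048 * 64)%N //; clear; lia.
Qed.

(** In [sd_lnm], 19 is 17 from the factor [2 ^ 17] of [short_model_bound], plus 1 for each of the
    two heights. *)
Record short_data (E : wcoef) (A B beta : int) (m : nat) : Prop := ShortData {
  sd_beta : 3 * b2 E = beta%:~R;
  sd_A : - 27 * c4 E = A%:~R;
  sd_B : - 54 * c6 E = B%:~R;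
  sd_m : (0 < m)%N;
  sd_Am : (`|A| <= m)%N;
  sd_Bm : (`|B| <= m)%N;
  sd_lnm : ln m%:R <= 19 * jdisc_height E :> R;
  sd_ln2 : ln 2 <= jdisc_height E :> R }.

Lemma short_dataP (E : wcoef) : integral_model E -> disc E != 0 ->
  exists A B beta m, short_data E A B beta m.
Proof.
rewrite /integral_model /= andbT => /and5P[].
move=> /intrP[x1 e1] /intrP[x2 e2] /intrP[x3 e3] /intrP[x4 e4] /intrP[x6 e6] d0.
pose B2 := x1 ^+ 2 + 4 * x2; pose B4 := 2 * x4 + x1 * x3; pose B6 := x3 ^+ 2 + 4 * x6.
pose B8 := x1 ^+ 2 * x6 + 4 * x2 * x6 - x1 * x3 * x4 + x2 * x3 ^+ 2 - x4 ^+ 2.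
pose z4 := B2 ^+ 2 - 24 * B4; pose z6 := - B2 ^+ 3 + 36 * B2 * B4 - 216 * B6.
pose D := - B2 ^+ 2 * B8 - 8 * B4 ^+ 3 - 27 * B6 ^+ 2 + 9 * B2 * B4 * B6.
have eb2 : b2 E = B2%:~R by rewrite /b2 e1 e2 /B2; ring.
have ez4 : c4 E = z4%:~R by rewrite /c4 /b2 /b4 e1 e2 e3 e4 /z4 /B2 /B4; ring.
have ez6 : c6 E = z6%:~R by rewrite /c6 /b2 /b4 /b6 e1 e2 e3 e4 e6 /z6 /B2 /B4 /B6; ring.
have eD : disc E = D%:~R.
  by rewrite /disc /b2 /b4 /b6 /b8 e1 e2 e3 e4 e6 /D /B2 /B4 /B6 /B8; ring.
have D0 : D != 0 by move: d0; rewrite eD intr_eq0.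
have e : z4 ^+ 3 - z6 ^+ 2 = 1728 * D.
  by rewrite /z4 /z6 /D /B2 /B4 /B6 /B8; ring.
have [hm hTS] := short_model_bound D0 ez4 ez6 eD e.
pose H := jdisc_height E.
have hT : ln (mht (jinv E))%:R <= H by rewrite -hgtE /H /jdisc_height le_max lexx.
have hS : ln (mht (disc E))%:R <= H by rewrite -hgtE /H /jdisc_height le_max lexx orbT.
have h2 : ln 2 <= H.
  move: hTS; rewrite leq_max => /orP[] h.
    by apply: le_trans hT; exact: (@ler_ln_nat 2).
  by apply: le_trans hS; exact: (@ler_ln_nat 2).
exists (- 27 * z4), (- 54 * z6), (3 * B2), (27 * `|z4| + 54 * `|z6| + 1)%N.
split.
- by rewrite eb2; ring.
- by rewrite ez4; ring.
- by rewrite ez6; ring.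
- by rewrite addn1.
- by clear; lia.
- by clear; lia.
- have := ler_ln_nat _ hm; rewrite addn1 => /(_ isT) hl; apply: le_trans hl _.
  have T0 := mht_gt0 (jinv E); have S0 := mht_gt0 (disc E).
  rewrite ln_natM ?expn_gt0 ?muln_gt0 ?T0 // (ln_natM T0 S0) (ln_natX 17 (isT : 0 < 2)%N).
  by rewrite -/H; lra.
- exact: h2.
Qed.

(** * Points of canonical height zero *)

Lemma odd_intD_even x y : (2 %| y)%Z -> odd_int (x + y) = odd_int x.
Proof. by move=> h; rewrite /odd_int rpredDr. Qed.

Lemma odd_num (x : rat) : (2 %| denq x)%Z -> odd_int (numq x).
Proof.
move=> h; rewrite /odd_int dvdzE; apply/negP => h'; rewrite dvdzE in h.
have := coprime_num_den x; rewrite /coprime => /eqP e.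
by have : (2 %| gcdn `|numq x| `|denq x|)%N; [rewrite dvdn_gcd h h'|rewrite e].
Qed.

Section TwoAdic.
Variables (C : curve rat) (A B : int) (m : nat).
Hypotheses (eA : cA C = A%:~R) (eB : cB C = B%:~R).
Hypotheses (m_gt0 : (0 < m)%N) (Am : (`|A| <= m)%N) (Bm : (`|B| <= m)%N).

(** With [b] even and [a] odd, the numerator of the duplication formula is odd and its denominator
    contains [4 b], so no power of 2 cancels. *)
Lemma double_two_adic (P : curve_point C) x y k : cval P = Some (x, y) ->
    (2 ^+ k.+1 %| denq x)%Z ->
  exists X Y, cval (P *+ 2) = Some (X, Y) /\ (2 ^+ k.+2 %| denq X)%Z.
Proof.
move=> eP hk; have h2 : (2 %| denq x)%Z by rewrite -[2]expr1 (dvdz_exp2 _ hk).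
have oa := odd_num h2.
have on : on_short C (Some (x, y)) by rewrite -eP; case: (P).
have y0 : y != 0.
  (* A zero ordinate would make [a ^ 3 + A a b ^ 2 + B b ^ 3] vanish, although it is odd. *)
  apply/eqP => y0; move: on; rewrite y0 /= expr0n /= eq_sym => /eqP e.
  have : (double_den A B x)%:~R = 0 :> rat by rewrite (double_denE eA eB) e mulr0 mul0r.
  move/eqP; rewrite intr_eq0 /double_den !mulf_eq0 (negPf (denq_neq0 x)) !orbF /= => /eqP z.
  have : odd_int (numq x ^+ 3 + A * numq x * denq x ^+ 2 + B * denq x ^+ 3).
    rewrite -addrA odd_intD_even ?exprS ?odd_intM ?oa //.
    by rewrite rpredD // ![denq x * _]mulrC !mulrA dvdz_mull.
  by rewrite z /odd_int dvdz0.
have [d0 [X [Y [e h]]]] := double_coord_frac eA eB on y0.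
exists X, Y; split; first by rewrite mulr2n cvalD eP.
have [k' [en ed]] := frac_multiple h.
have on' : odd_int (double_num A B x).
  have -> : double_num A B x = numq x ^+ 4 + denq x * (- 2 * A * numq x ^+ 2 * denq x
      - 8 * B * numq x * denq x ^+ 2 + A ^+ 2 * denq x ^+ 3).
    by rewrite /double_num; ring.
  by rewrite odd_intD_even ?dvdz_mulr // !exprS !odd_intM oa.
have ok' : odd_int k' by move: on'; rewrite en odd_intM => /andP[].
rewrite -(@dvdz_cancel_odd k') // -ed /double_den exprS -!mulrA.
rewrite (_ : 4 = 2 * 2) // -mulrA dvdz_mul // mulrCA; apply: dvdz_mulr hk.
Qed.

(** An even denominator would make that of [2 ^ n P] at least [2 ^ (n + 1)], whereas all these
    multiples have canonical height 0 and so naive height at most [hconst m]. *)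
Lemma height0_odd_den (P : curve_point C) x y : canonical_height P = 0 ->
  cval P = Some (x, y) -> odd_int (denq x).
Proof.
move=> q0 eP; apply/negP => h2.
have hq := canonical_height_quadratic eA eB m_gt0 Am Bm.
have it n : exists X Y, cval (P *+ 2 ^ n) = Some (X, Y) /\ (2 ^+ n.+1 %| denq X)%Z.
  elim: n => [|n [X [Y [e h]]]]; first by exists x, y; rewrite expr1.
  have [X' [Y' [e' h']]] := double_two_adic e h.
  by exists X', Y'; rewrite expnS mulnC mulrnA.
have low n : n.+1%:R * ln 2 <= hconst m :> R.
  have [X [Y [e h]]] := it n.
  have qn : canonical_height (P *+ 2 ^ n) = 0.
    have := quadraticMz hq P (2 ^ n)%N; rewrite q0 mulr0 => <-.
    by rewrite -pmulrn.
  have := canonical_height_dist eA eB m_gt0 Am Bm (P *+ 2 ^ n).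
  rewrite qn sub0r normrN ger0_norm ?hpt_ge0 //; apply: le_trans.
  rewrite /hpt hxE e -(ln_natX n.+1 (isT : 0 < 2)%N) ler_ln_nat ?expn_gt0 //=.
  apply: leq_trans (leq_maxr _ _); apply: dvdn_leq.
    by rewrite absz_gt0 denq_neq0.
  by move: h; rewrite dvdzE abszX.
have l2 : 0 < ln 2 :> R by rewrite ln_gt0 // ltr1n.
have := low (Num.bound (hconst m / ln 2)).
rewrite -ler_pdivlMr // leNgt; apply/negP; rewrite negbK.
apply: lt_trans (archi_boundP _) _; last by rewrite ltr_nat.
by rewrite divr_ge0 ?(ltW l2) // (hconst_ge0 eA eB m_gt0 Am Bm).
Qed.

(** The slope [l] of the line through [P] and [-Q] satisfies [l (x2 - x1) = -(y1 + y2)]. As [l ^ 2]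
    is the abscissa of [P - Q] plus an integer, [l] too has an odd denominator. *)
Lemma same_class_divisible (P Q : curve_point C) (x1 y1 x2 y2 : int) (e : nat) :
    cval P = Some (x1%:~R, y1%:~R) -> cval Q = Some (x2%:~R, y2%:~R) -> x1 != x2 ->
    canonical_height (P - Q) = 0 -> (2 ^+ e %| x1 - x2)%Z -> (2 ^+ e %| y1 + y2)%Z.
Proof.
move=> eP eQ n12 q0 hd.
pose l : rat := (- y2%:~R - y1%:~R) / (x2%:~R - x1%:~R).
have d0 : x2%:~R - x1%:~R != 0 :> rat by rewrite subr_eq0 eqr_int eq_sym.
have [Y eS] : exists Y, cval (P - Q) = Some (l ^+ 2 - x1%:~R - x2%:~R, Y).
  rewrite cvalD cvalN eP eQ /= eqr_int (negPf n12) /= /slope eqr_int (negPf n12).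
  by eexists.
have oX := height0_odd_den q0 eS.
pose p := numq l; pose s := denq l.
have os : odd_int s.
  apply/negP => s2; have op := odd_num s2.
  have : (l ^+ 2 - x1%:~R - x2%:~R) * (s ^+ 2)%:~R = (p ^+ 2 - (x1 + x2) * s ^+ 2)%:~R.
    transitivity (p%:~R ^+ 2 - (x1%:~R + x2%:~R) * s%:~R ^+ 2 : rat); last by ring.
    by rewrite /p numqE -/s; move: (l) (s) => l' s'; ring.
  move=> /frac_multiple[k [ek ek']].
  have : odd_int (p ^+ 2 - (x1 + x2) * s ^+ 2).
    by rewrite odd_intD_even ?rpredN ?dvdz_mull // !exprS !odd_intM op.
  rewrite ek odd_intM => /andP[ok _].
  have : odd_int (s ^+ 2) by rewrite ek' odd_intM ok.
  by rewrite /odd_int exprS dvdz_mulr.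
have : l * (x2 - x1)%:~R = (- (y1 + y2))%:~R.
  by rewrite rmorphB rmorphN rmorphD /= /l divfK //; ring.
move=> /frac_multiple[k [ek ek']].
have hd' : (2 ^+ e %| x2 - x1)%Z by rewrite -opprB rpredN.
suff : (2 ^+ e %| - (y1 + y2))%Z by rewrite rpredN.
by rewrite ek dvdz_mulr // -(@dvdz_cancel_odd s) // mulrC -ek'.
Qed.

End TwoAdic.

(** * Arithmetic progressions *)

Section Progression.
Variables (C : curve rat) (A B : int) (m : nat).
Hypotheses (eA : cA C = A%:~R) (eB : cB C = B%:~R).
Hypotheses (m_gt0 : (0 < m)%N) (Am : (`|A| <= m)%N) (Bm : (`|B| <= m)%N).
Variables (N : nat) (p : 'I_N -> curve_point C) (X Y : nat -> int) (a d : int).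
Hypothesis d0 : d != 0.
Hypothesis pE : forall i : 'I_N, cval (p i) = Some ((X i)%:~R, (Y i)%:~R).
Hypothesis XE : forall i : 'I_N, X i = a + i%:Z * d.

Let q := @canonical_height C.
Let hq : quadratic q := canonical_height_quadratic eA eB m_gt0 Am Bm.

Lemma progression_eq (i : 'I_N) : Y i ^+ 2 = X i ^+ 3 + A * X i + B.
Proof.
have : on_short C (cval (p i)) by case: (p i).
rewrite pE /= eA eB => /eqP e; apply: (@intr_inj rat).
by move: e; rewrite !(rmorphD, rmorphM, rmorphXn).
Qed.

Lemma progression_inj (i j : 'I_N) : X i = X j -> i = j.
Proof.
rewrite !XE => /addrI /(mulIf d0) [e]; exact: val_inj.
Qed.

Lemma torsion_class_card n (I : {set 'I_N}) : (N <= 16 ^ n)%N ->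
    ~ ((2 ^+ 8 %| A)%Z /\ (2 ^+ 12 %| B)%Z) ->
    (forall i j, i \in I -> j \in I -> q (p i - p j) = 0) ->
  (#|I| <= 4 * 14 ^ n)%N.
Proof.
move=> hN nAB hI.
have winj : injective (widen_ord hN) by move=> i j /(congr1 val) /= /val_inj.
rewrite -(card_imset _ winj).
apply: (@tree_card X Y a d A B n _ d0) => //.
- by move=> _ /imsetP[i _ ->]; exact: XE.
- by move=> _ /imsetP[i _ ->]; exact: progression_eq.
move=> _ _ /imsetP[i iI ->] /imsetP[j jI ->] nij e.
apply: (same_class_divisible eA eB m_gt0 Am Bm (pE i) (pE j)); last exact: hI.
by apply: contraNneq nij => /progression_inj ->.
Qed.

Let q0D x y : q x = 0 -> q y = 0 -> q (x + y) = 0.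
Proof. by move=> x0 y0; rewrite quadraticD // x0 y0 polar_le0 // mulr0 !addr0. Qed.

(** Constant on classes, because [pick] depends only on the extension of its predicate; the default
    is never reached, as [i] itself qualifies. *)
Let rep (i : 'I_N) : 'I_N := odflt i [pick j : 'I_N | q (p i - p j) == 0].

Let repP i : q (p i - p (rep i)) = 0.
Proof.
rewrite /rep; case: pickP => [j /eqP //|/(_ i)].
by rewrite subrr quadratic0 // eqxx.
Qed.

Let rep_eq i j : q (p i - p j) = 0 -> rep i = rep j.
Proof.
move=> ij; have ji : q (p j - p i) = 0 by rewrite -opprB quadraticN.
rewrite /rep (eq_pick (Q := fun k => q (p j - p k) == 0)); last first.
  move=> k; apply/eqP/eqP => h.
    by have := q0D ji h; rewrite addrA subrK.
  by have := q0D ij h; rewrite addrA subrK.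
by case: pickP => [//|/(_ j)]; rewrite subrr quadratic0 // eqxx.
Qed.

Lemma progression_card_le n W : (N <= 16 ^ n)%N ->
    ~ ((2 ^+ 8 %| A)%Z /\ (2 ^+ 12 %| B)%Z) ->
    (forall (T : finType) (f : T -> 'I_N),
      (forall s t, s != t -> q (p (f s) - p (f t)) <> 0) -> (#|T| <= W)%N) ->
  (N <= W * (4 * 14 ^ n))%N.
Proof.
move=> hN nAB hW; pose I := [set rep i | i : 'I_N].
have cI : (#|I| <= W)%N.
  rewrite -(card_sig (mem I)); apply: (hW _ (fun t => sval t)) => s t nst e.
  move/negP: nst; apply; apply/eqP; apply: val_inj.
  case: s t e => s sI [t tI] /= e; case/imsetP: (sI) => i _ es; case/imsetP: (tI) => j _ et.
  have rs : rep s = s by rewrite es -(rep_eq (repP i)).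
  have rt : rep t = t by rewrite et -(rep_eq (repP j)).
  by rewrite -rs -rt; exact: rep_eq.
have -> : N = (\sum_(k in I) #|[set i | rep i == k]|)%N.
  rewrite -{1}(card_ord N) -sum1_card (partition_big rep (mem I)) /=; last first.
    by move=> i _; exact: imset_f.
  apply: eq_bigr => k _; rewrite -sum1_card; apply: eq_bigl => i.
  by rewrite !inE.
apply: (@leq_trans (\sum_(k in I) 4 * 14 ^ n)%N).
  apply: leq_sum => k _; apply: torsion_class_card => // i j.
  rewrite !inE => /eqP ei /eqP ej.
  have := q0D (repP i) (etrans (quadraticN hq _) (repP j)).
  by rewrite ei ej opprB addrA subrK.
by rewrite sum_nat_const leq_mul2r cI orbT.
Qed.

End Progression.

(** * From a power saving to a bound *)

Lemma pow_log_le (a b x y : nat) n : a = (y * x)%N -> b = (y ^ 4)%N ->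
  (x ^ 6 <= y ^ 17)%N -> ((a ^ n) ^ 24 <= (b ^ n) ^ 23)%N.
Proof.
move=> -> -> h; case: n => [|n]; first by rewrite !expn0 !exp1n.
(* It remains to compare [y ^ 24 x ^ 24] with [y ^ 92 = y ^ 24 y ^ 68], the fourth power of the
   hypothesis. *)
rewrite expnAC [X in (_ <= X)%N]expnAC leq_exp2r //.
rewrite expnMn -[X in (_ <= X)%N]expnM (expnD y 24 68).
by rewrite leq_mul2l (expnM x 6 4) (expnM y 17 4) leq_exp2r // h orbT.
Qed.

(* [log 14 / log 16 <= 23 / 24], since [7 ^ 6 <= 2 ^ 17]. *)
Lemma pow14_pow16 n : ((14 ^ n) ^ 24 <= (16 ^ n) ^ 23)%N.
Proof.
by apply: (@pow_log_le 14 16 7 2 n).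
Qed.

(** For [16 ^ n < N <= 16 ^ (n + 1)] the hypothesis gives [16 ^ n <= K W 14 ^ n]; raised to the 24th
    power and divided by [(16 ^ n) ^ 23] this is [16 ^ n <= (K W) ^ 24]. *)
Lemma geometric_bound (N W K : nat) : (0 < W)%N -> (4 * 14 <= K)%N ->
  (forall n, (N <= 16 ^ n)%N -> (N <= W * (4 * 14 ^ n))%N) ->
  (N <= 16 * K ^ 24 * W ^ 24)%N.
Proof.
move=> W0 K4 h; have K0 : (0 < K)%N by apply: leq_trans K4.
have [N1|N1] := leqP N 1.
  by apply: leq_trans N1 _; rewrite 2!muln_gt0 !expn_gt0 W0 K0.
have /andP[lo hi] := up_log_bounds (isT : 1 < 16)%N N1.
have {}h := h _ hi; move: lo hi h; rewrite -[up_log 16 N]prednK; last by rewrite up_log_gt0.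
move: (up_log 16 N).-1 => n; rewrite [n.+1.-1]/= => lo hi h.
have u0 : (0 < (16 ^ n) ^ 23)%N by rewrite !expn_gt0.
have h1 : (16 ^ n <= K * W * 14 ^ n)%N.
  apply: leq_trans (ltnW lo) _; apply: leq_trans h _.
  rewrite expnS [(4 * _)%N]mulnA mulnCA mulnA; apply: leq_mul => //.
  by rewrite leq_mul2r K4 orbT.
have h2 : (16 ^ n <= (K * W) ^ 24)%N.
  rewrite -(leq_pmul2r u0) -expnS.
  apply: (@leq_trans ((K * W * 14 ^ n) ^ 24)%N); first by rewrite leq_exp2r.
  by rewrite [X in (X <= _)%N]expnMn leq_mul2l pow14_pow16 orbT.
by apply: leq_trans hi _; rewrite expnS -mulnA leq_mul2l -expnMn h2 orbT.
Qed.

(** The ordinates have size about [M ^ (3/2)], so the numerator of the abscissa of the sum is cubic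
    in [M]. The constant [12 + 8] is rounded up to [2 ^ 5] for its logarithm. *)
Lemma sum_point_bound (F : realFieldType) (A B x1 y1 x2 y2 m M : F) :
    `|A| <= m -> `|B| <= m -> m <= M -> 1 <= M -> `|x1| <= M -> `|x2| <= M ->
    y1 ^+ 2 = x1 ^+ 3 + A * x1 + B -> y2 ^+ 2 = x2 ^+ 3 + A * x2 + B ->
  `|(y2 - y1) ^+ 2 - (x1 + x2) * (x2 - x1) ^+ 2| <= 32 * M ^+ 3 /\
  `|(x2 - x1) ^+ 2| <= 32 * M ^+ 3.
Proof.
move=> hA hB mM M1 h1 h2 e1 e2; have M0 : 0 <= M by lra.
have [_ p1 p2 p3 _] := pow_chain M1 (ler01 : 0 <= 1 :> F).
have sq (x y : F) : `|x| <= M -> y ^+ 2 = x ^+ 3 + A * x + B -> y ^+ 2 <= 3 * M ^+ 3.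
  move=> hx ->; apply: le_trans (ler_norm _) _.
  apply: le_trans (normD_le (normD_le (normX_le 3 hx) (normM_le hA hx)) hB) _.
  have : m * M <= M ^+ 2 by rewrite expr2 ler_wpM2r.
  by lra.
have d12 : `|x2 - x1| <= 2 * M.
  by apply: le_trans (normD_le h2 (normN_le h1)) _; lra.
have s12 : `|x1 + x2| <= 2 * M by apply: le_trans (normD_le h1 h2) _; lra.
have dd : `|(x2 - x1) ^+ 2| <= 4 * M ^+ 2.
  by apply: le_trans (normX_le 2 d12) _; rewrite exprMn; lra.
split; last by apply: le_trans dd _; lra.
have yy : `|(y2 - y1) ^+ 2| <= 12 * M ^+ 3.
  rewrite ger0_norm ?sqr_ge0 //; have := sq _ _ h1 e1; have := sq _ _ h2 e2.
  have := sqr_ge0 (y1 + y2); lra.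
apply: le_trans (normD_le yy (normN_le (normM_le s12 dd))) _.
have -> : 2 * M * (4 * M ^+ 2) = 8 * M ^+ 3 by ring.
by have := exprn_ge0 3 M0; lra.
Qed.

Section LargePoints.
Variables (C : curve rat) (A B : int) (m : nat).
Hypotheses (eA : cA C = A%:~R) (eB : cB C = B%:~R).
Hypotheses (m_gt0 : (0 < m)%N) (Am : (`|A| <= m)%N) (Bm : (`|B| <= m)%N).

Let q := @canonical_height C.
Let kappa := hconst m.
Let dist := canonical_height_dist eA eB m_gt0 Am Bm.

Lemma integral_point_height (P : curve_point C) (x y : int) M :
  cval P = Some (x%:~R, y%:~R) -> (`|x| <= M)%N -> (0 < M)%N -> q P <= ln M%:R + kappa.
Proof.
move=> eP xM M0; have := dist P; rewrite ler_distl => /andP[_]; rewrite -/q -/kappa.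
have : hpt P <= ln M%:R.
  rewrite /hpt hxE eP; apply: ler_ln_nat; first exact: mht_gt0.
  by rewrite /= /mht numq_int denq_int geq_max xM.
lra.
Qed.

Lemma integral_point_height_ge (P : curve_point C) (x y : int) M :
  cval P = Some (x%:~R, y%:~R) -> (M <= 2 * `|x|)%N -> (0 < M)%N ->
  ln M%:R - ln 2 - kappa <= q P.
Proof.
move=> eP xM M0; have := dist P; rewrite ler_distl => /andP[h _]; move: h.
rewrite -/q -/kappa; have : ln M%:R <= ln 2 + hpt P.
  rewrite /hpt hxE eP /= -(ln_natM (isT : 0 < 2)%N (mht_gt0 _)); apply: ler_ln_nat => //.
  by apply: leq_trans xM _; rewrite leq_mul2l mht_int.
lra.
Qed.

Lemma sum_point_height (P Q : curve_point C) (x1 y1 x2 y2 : int) M :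
    cval P = Some (x1%:~R, y1%:~R) -> cval Q = Some (x2%:~R, y2%:~R) -> x1 != x2 ->
    (`|x1| <= M)%N -> (`|x2| <= M)%N -> (m <= M)%N ->
  q (P + Q) <= 3 * ln M%:R + 5 * ln 2 + kappa.
Proof.
move=> eP eQ n12 h1 h2 mM; have M0 : (0 < M)%N by apply: leq_trans mM.
have := dist (P + Q); rewrite ler_distl => /andP[_]; rewrite -/q -/kappa.
suff : hpt (P + Q) <= 3 * ln M%:R + 5 * ln 2 by lra.
have /eqP e1 : on_short C (Some (x1%:~R, y1%:~R)) by rewrite -eP; case: (P).
have /eqP e2 : on_short C (Some (x2%:~R, y2%:~R)) by rewrite -eQ; case: (Q).
rewrite eA eB in e1 e2.
pose num := (y2 - y1) ^+ 2 - (x1 + x2) * (x2 - x1) ^+ 2; pose den := (x2 - x1) ^+ 2.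
have den0 : den != 0 by rewrite expf_neq0 // subr_eq0 eq_sym.
have [Y [x [eS ex]]] : exists Y x, cval (P + Q) = Some (x, Y) /\ x * den%:~R = num%:~R.
  do 2 eexists; split.
    by rewrite cvalD eP eQ /= eqr_int (negPf n12) /= /slope eqr_int (negPf n12); reflexivity.
  have dr0 : x2%:~R - x1%:~R != 0 :> rat by rewrite subr_eq0 eqr_int eq_sym.
  transitivity ((y2%:~R - y1%:~R) ^+ 2 - (x1%:~R + x2%:~R) * (x2%:~R - x1%:~R) ^+ 2 : rat).
    have -> : den%:~R = (x2%:~R - x1%:~R) ^+ 2 :> rat by rewrite /den; ring.
    by field; rewrite dr0.
  by rewrite /num; ring.
have := @sum_point_bound rat A%:~R B%:~R x1%:~R y1%:~R x2%:~R y2%:~R m%:R M%:R.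
rewrite -!absz_le_rat ler_nat ler1n => /(_ Am Bm mM M0 h1 h2 e1 e2)[b1 b2].
have hb : (mht x <= 32 * M ^ 3)%N.
  apply: leq_trans (mht_frac_le den0 ex) _; rewrite geq_max !absz_le_rat natrM natrX.
  apply/andP; split; [apply: etrans b1|apply: etrans b2]; congr (`|_| <= _).
    by rewrite /num; ring.
  by rewrite /den; ring.
have := ler_ln_nat (mht_gt0 x) hb; rewrite ln_natM ?expn_gt0 ?M0 // ln_natX //.
rewrite /hpt hxE eS /= (_ : 32 = 2 ^ 5)%N // ln_natX //.
lra.
Qed.

(** The parallelogram law leaves [4 (L - ln 2 - kappa) - (3 L + 5 ln 2 + kappa)], where
    [L = ln M]. *)
Lemma large_points_separated (P Q : curve_point C) (x1 y1 x2 y2 : int) M :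
    cval P = Some (x1%:~R, y1%:~R) -> cval Q = Some (x2%:~R, y2%:~R) -> x1 != x2 ->
    (`|x1| <= M)%N -> (`|x2| <= M)%N -> (m <= M)%N ->
    (M <= 2 * `|x1|)%N -> (M <= 2 * `|x2|)%N ->
  ln M%:R - 9 * ln 2 - 5 * kappa <= q (P - Q).
Proof.
move=> eP eQ n12 h1 h2 mM l1 l2; have M0 : (0 < M)%N by apply: leq_trans mM.
have := sum_point_height eP eQ n12 h1 h2 mM.
have := integral_point_height_ge eP l1 M0; have := integral_point_height_ge eQ l2 M0.
have [_ /(_ P Q)] := canonical_height_quadratic eA eB m_gt0 Am Bm; rewrite -/q.
lra.
Qed.

End LargePoints.

(** For [u >= 0] the hypothesis gives [- 2 u <= n e <= 0], so a quarter of the way the term has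
    dropped by at most [u / 2]. *)
Lemma progression_end (F : realFieldType) (u e : F) (n t : nat) : (0 < n)%N -> (t <= n)%N ->
    `|u + n%:R * e| <= `|u| ->
  `|u + t%:R * e| <= `|u| /\ ((4 * t <= n)%N -> `|u| <= 2 * `|u + t%:R * e|).
Proof.
move=> n0 tn; wlog u0 : u e / 0 <= u => [hw|].
  have [u0|u0] := leP 0 u; first exact: hw.
  have := hw (- u) (- e); rewrite oppr_ge0 => /(_ (ltW u0)).
  by rewrite !mulrN -!opprD !normrN.
rewrite (ger0_norm u0) => h; have n0' : 0 < n%:R :> F by rewrite ltr0n.
have e0 : e <= 0 by rewrite -(pmulr_rle0 _ n0'); have := le_trans (ler_norm _) h; lra.
have te : n%:R * e <= t%:R * e by rewrite ler_wnM2r // ler_nat.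
have t0 : t%:R * e <= 0 by rewrite mulr_ge0_le0.
have h' : - u <= u + n%:R * e by rewrite ler_norml in h; case/andP: h.
split; first by rewrite ler_norml; apply/andP; split; lra.
move=> t4; have te4 : n%:R * e <= 4 * (t%:R * e).
  by rewrite mulrA ler_wnM2r // -natrM ler_nat.
by apply: le_trans (ler_wpM2l _ (ler_norm _)); lra.
Qed.

(** [N] is the last index here. [M] is the absolute value at the larger end, and [f] runs through
    the quarter next to it, reversing the progression if that end is the last term. *)
Lemma progression_large_half (N : nat) (X : nat -> int) (a d : int) :
    (forall i, (i <= N)%N -> X i = a + i%:Z * d) ->
  exists M : nat, (forall i, (i <= N)%N -> (`|X i| <= M)%N) /\
    exists f : 'I_(N %/ 4).+1 -> 'I_N.+1, injective f /\
      forall t, (M <= 2 * `|X (f t)|)%N.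
Proof.
move=> eX; case: (posnP N) => [N0|N0].
  subst N; exists `|X 0%N|%N; split; first by move=> i; rewrite leqn0 => /eqP ->.
  exists id; split=> // t; rewrite ord1 /=; lia.
have end_case (Z : nat -> int) (b e : int) : (forall i, (i <= N)%N -> Z i = b + i%:Z * e) ->
    (`|Z N| <= `|Z 0%N|)%N -> forall t, (t <= N)%N ->
    (`|Z t| <= `|Z 0%N|)%N /\ ((4 * t <= N)%N -> (`|Z 0%N| <= 2 * `|Z t|)%N).
  move=> eZ hZ t tN.
  have z i : (i <= N)%N -> (Z i)%:~R = (Z 0%N)%:~R + i%:R * e%:~R :> rat.
    by move=> iN; rewrite !eZ // mul0r addr0 rmorphD rmorphM /= -pmulrn.
  have := @progression_end rat (Z 0%N)%:~R e%:~R N t N0 tN.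
  rewrite -!z // -!intr_norm -!natr_absz -natrM !ler_nat; exact.
have le4 (t : 'I_(N %/ 4).+1) : (4 * t <= N)%N.
  by have := ltn_ord t; rewrite ltnS leq_divRL // mulnC.
have [h|h] := leqP `|X N| `|X 0%N|.
  have H := end_case X a d eX h; exists `|X 0%N|%N; split; first by move=> i /H[].
  have lt (t : 'I_(N %/ 4).+1) : (t < N.+1)%N by have := le4 t; lia.
  exists (fun t => Ordinal (lt t)); split; first by move=> s t [] /val_inj.
  by move=> t; have [_ ->] := H t (lt t).
have eX' i : (i <= N)%N -> X (N - i)%N = X N + i%:Z * - d.
  by move=> iN; rewrite !eX ?leq_subr // -subzn //; ring.
have := end_case (fun i => X (N - i)%N) (X N) (- d) eX'; rewrite subnn subn0.
move=> /(_ (ltnW h)) H; exists `|X N|%N; split.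
  by move=> i iN; have [] := H _ (leq_subr i N); rewrite subKn.
have lt (t : 'I_(N %/ 4).+1) : (N - t < N.+1)%N by rewrite ltnS leq_subr.
exists (fun t => Ordinal (lt t)); split.
  by move=> s t [e]; apply: val_inj => /=; have := le4 s; have := le4 t; lia.
by move=> t; have := le4 t => t4; have [|_ ->] // := H t _; lia.
Qed.

(** [800 <= 2 ^ 10] and [10 + 5 * 19 = 105]. *)
Lemma hconst_le (E : wcoef) A B beta m : short_data E A B beta m ->
  hconst m <= 105 * jdisc_height E.
Proof.
move=> sd; have m0 := sd_m sd; have m5 : (0 < m ^ 5)%N by rewrite expn_gt0 m0.
have : (800 * m ^ 5 <= 2 ^ 10 * m ^ 5)%N by rewrite leq_mul2r orbT.
have p10 : (0 < 2 ^ 10)%N by rewrite expn_gt0.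
have c0 : (0 < 800 * m ^ 5)%N by rewrite muln_gt0 m5.
move=> /(ler_ln_nat c0); rewrite -/(hconst m) (ln_natM p10 m5) (ln_natX 5 m0).
rewrite (ln_natX 10 (isT : 0 < 2)%N).
by have := sd_lnm sd; have := sd_ln2 sd; lra.
Qed.

Section CurveBounds.
Variables (E : wcoef) (d0 : disc E != 0) (A B beta : int) (m : nat).
Hypothesis sd : short_data E A B beta m.

Let C := short_curve d0.
Let eA : cA C = A%:~R := sd_A sd.
Let eB : cB C = B%:~R := sd_B sd.
Let q := @canonical_height C.
Let hq : quadratic q := canonical_height_quadratic eA eB (sd_m sd) (sd_Am sd) (sd_Bm sd).

Lemma rank_separated_card r (T : finType) (p : T -> curve_point C) (M : nat) (delta : R) :
    rank_is E r -> 0 < delta -> (0 < M)%N ->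
    (forall t, q (p t) <= M%:R ^+ 2 * delta) ->
    (forall s t, s != t -> delta <= q (p s - p t)) ->
  (#|T| <= (2 ^ (2 * M + 3)) ^ r)%N.
Proof.
move=> hr d1 M0 hM hs; have [|l [ladd lq]] := @quadratic_sum_squares R _ r q hq.
  move=> Q; have [n [n0 e]] := rank_dependent hr Q.
  by exists n; split; [exact: n0|rewrite e; exact: quadratic0 hq].
apply: (@separated_card R r T (fun t j => l j (p t)) M delta d1 M0) => [t|s t st].
  by rewrite -lq; exact: hM.
by under eq_bigr do rewrite -ladd; rewrite -lq; exact: hs.
Qed.

(** A torsion point has height 0, since [n ^ 2 q P = q (n P) = 0]; so Lang's inequality applies
    whenever the height is nonzero. *)
Lemma Lang_height_gap cL (P : curve_point C) : global_minimal E -> Lang_conjecture cL ->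
  q P <> 0 -> cL * jdisc_height E <= q P.
Proof.
move=> minE lang q0; have [P' on eP] := spoint_surj P.
rewrite -eP /q -(hhatE (sd_beta sd) eA eB (sd_m sd) (sd_Am sd) (sd_Bm sd) on).
apply: (lang E minE P' on) => n n0 e; apply: q0.
have [_ en] := pnmulP d0 n on; move: en; rewrite e spoint0 eP => en.
have := quadraticMz hq P n; rewrite -pmulrn -en (quadratic0 hq) => /esym/eqP.
by rewrite mulf_eq0 expf_eq0 /= pnatr_eq0 (negPf (lt0n_neq0 n0)) => /eqP.
Qed.

End CurveBounds.

(** * The two cases and the theorem *)

Lemma int_progression (F : realFieldType) (x y e : int) (a d : F) (i : nat) :
    x%:~R = a + 0%:R * d -> e%:~R = d -> y%:~R = a + i%:R * d ->
  y = x + i%:Z * e.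
Proof.
rewrite mul0r addr0 => <- <- hy; apply: (@intr_inj F).
by rewrite hy rmorphD rmorphM.
Qed.

Lemma integral_progression_bound E cL r (M K N : nat) (P : nat -> rat * rat) :
    global_minimal E -> 0 < cL -> Lang_conjecture cL -> rank_is E r ->
    (1 < M)%N -> 1173 <= M%:R ^+ 2 * cL -> (4 * 14 <= K)%N ->
    (forall i, (i < N)%N ->
       [/\ on_curve E (Some (P i)), sX E (P i) \is a Num.int & sY E (P i) \is a Num.int]) ->
    (exists a d : rat, d != 0 /\ forall i, (i < N)%N -> sX E (P i) = a + i%:R * d) ->
  (N <= 16 * K ^ 24 * ((2 ^ (2 * M + 3)) ^ r) ^ 24)%N.
Proof.
case: N => [//|n] minE cL0 lang hr M1 hM hK hP [a [d [dn0 ap]]].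
have [int_E d0 _] := minE; have [A [B [beta [m sd]]]] := short_dataP int_E d0.
pose H := jdisc_height E; pose q := @canonical_height (short_curve d0).
have eA : cA (short_curve d0) = A%:~R := sd_A sd.
have eB : cB (short_curve d0) = B%:~R := sd_B sd.
have H0 : 0 < H by apply: lt_le_trans (sd_ln2 sd); apply: ln_gt0; rewrite ltr1n.
have kH := hconst_le sd; rewrite -/H in kH.
pose p (i : 'I_n.+1) := spoint d0 (Some (P i)).
pose X i := numq (sX E (P i)); pose Y i := numq (sY E (P i)).
have Xr i : (i < n.+1)%N -> (X i)%:~R = sX E (P i) by move=> /hP[_ h _]; exact: numqK.
have Yr i : (i < n.+1)%N -> (Y i)%:~R = sY E (P i) by move=> /hP[_ _ h]; exact: numqK.
have pE (i : 'I_n.+1) : cval (p i) = Some ((X i)%:~R, (Y i)%:~R).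
  rewrite (Xr i (ltn_ord i)) (Yr i (ltn_ord i)) /p spointE; first exact: erefl.
  by case: (hP i (ltn_ord i)).
(* A single point leaves the common difference undetermined; any nonzero integer will do there. *)
pose d' : int := if n is 0 then 1 else X 1%N - X 0%N.
have Xd i (hi : (i < n.+1)%N) : (X i)%:~R = a + i%:R * d := etrans (Xr i hi) (ap i hi).
have dE : (0 < n)%N -> d'%:~R = d.
  rewrite /d'; case: (n) Xd => [_ /notF//|k Xd _]; rewrite intrB (Xd 1%N isT) (Xd 0%N isT).
  by rewrite mul0r mul1r addr0 addrC addKr.
have d'0 : d' != 0.
  have [n0|n0] := posnP n; first by rewrite /d' n0.
  by rewrite -(intr_eq0 rat) (dE n0).
have XE i : (i <= n)%N -> X i = X 0%N + i%:Z * d'.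
  move=> hi; have [n0|n0] := posnP n.
    have -> : i = 0%N by apply/eqP; rewrite -leqn0 -n0.
    by rewrite mul0r addr0.
  exact: int_progression (Xd 0%N isT) (dE n0) (Xd i hi).
have [Xm [hXm [f [finj hf]]]] := progression_large_half XE.
(* The maximum with 1 keeps the argument of the logarithm positive when [Xm = 0]. *)
pose L : R := ln (maxn Xm 1)%:R.
have Xm1 : (0 < maxn Xm 1)%N by rewrite leq_max orbT.
have W0 k : (0 < (2 ^ k) ^ r)%N by rewrite !expn_gt0.
have XEo (i : 'I_n.+1) : X i = X 0%N + i%:Z * d' := XE i (ltn_ord i).
have le_Xm (i : 'I_n.+1) : (`|X i| <= Xm)%N := hXm i (ltn_ord i).
have qle (i : 'I_n.+1) : q (p i) <= L + hconst m.
  apply: (integral_point_height eA eB (sd_m sd) (sd_Am sd) (sd_Bm sd) (pE i) _ Xm1).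
  exact: leq_trans (le_Xm i) (leq_maxl _ _).
(* The threshold makes [L - 9 ln 2 - 5 kappa >= L / 2]: the error is at most
   [(9 + 5 * 105) H = 534 H]. *)
have [caseA|caseB] := leP L (1068 * H).
  apply: (geometric_bound (W0 _) hK) => k hk.
  apply: (progression_card_le eA eB (sd_m sd) (sd_Am sd) (sd_Bm sd) d'0 pE XEo hk).
    exact: minimal_not_divisible minE (sd_A sd) (sd_B sd).
  move=> T g hg; apply: (rank_separated_card sd (p := p \o g) hr (mulr_gt0 cL0 H0) (ltnW M1)).
    (* Heights are at most [1068 H + 105 H = 1173 H], hence at most [M ^ 2] times Lang's gap
       [cL H]. *)
    move=> t; apply: le_trans (qle _) _; rewrite mulrA.
    apply: le_trans (ler_wpM2r (ltW H0) hM); clear -caseA kH; lra.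
  by move=> s t st; apply: (Lang_height_gap sd minE lang); exact: hg.
have L0 : 0 < L by apply: lt_trans caseB; apply: mulr_gt0 H0; rewrite ltr0n.
have Xm0 : (1 < Xm)%N.
  rewrite ltnNge; apply/negP => h; move: L0; rewrite /L (maxn_idPr h) ln1 ltxx.
  exact: notF.
have eL : L = ln Xm%:R by rewrite /L; congr (ln _%:R); apply/maxn_idPl/ltnW.
have l2H := sd_ln2 sd; have lmH := sd_lnm sd; rewrite -/H in l2H lmH.
have mX : (m <= Xm)%N.
  rewrite leqNgt; apply/negP => /ltnW h.
  have := ler_ln_nat (ltnW Xm0) h; rewrite -eL.
  by clear -caseB lmH H0; lra.
have sep s t : s != t -> L / 2 <= q (p (f s) - p (f t)).
  move=> st; have nX : X (f s) != X (f t).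
    by apply: contraNneq st => /(progression_inj d'0 XEo)/finj ->.
  have := large_points_separated eA eB (sd_m sd) (sd_Am sd) (sd_Bm sd)
    (pE (f s)) (pE (f t)) nX (le_Xm _) (le_Xm _) mX (hf s) (hf t).
  rewrite -eL -/q; move: (q _) => z; clear -caseB l2H kH; lra.
(* The ball has squared radius [2 L], so with separation [L / 2] the packing bound applies with
   radius parameter 2. *)
have qf t : q (p (f t)) <= 2%:R ^+ 2 * (L / 2).
  apply: le_trans (qle _) _; clear -caseB kH H0; lra.
have L20 : 0 < L / 2 by apply: divr_gt0 L0 _; rewrite ltr0n.
have := rank_separated_card sd (p := p \o f) hr L20 (isT : 0 < 2)%N qf sep.
rewrite card_ord => h.
apply: (@leq_trans (4 * (n %/ 4).+1)%N); first by clear; lia.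
apply: leq_trans (leq_mul (leqnn 4) h) _; apply: leq_mul.
  apply: (@leq_trans 16); first exact: isT.
  by apply: leq_pmulr; rewrite expn_gt0 (leq_trans _ hK).
apply: (@leq_trans ((2 ^ (2 * M + 3)) ^ r)%N); last first.
  rewrite -[X in (X <= _)%N]expn1; apply: leq_pexp2l; [exact: W0|exact: isT].
case: (r) => [|s]; first by rewrite !expn0.
rewrite leq_exp2r; last exact: ltn0Sn.
apply: leq_pexp2l; first exact: isT.
by rewrite leq_add2r leq_mul2l M1 orbT.
Qed.

Theorem theorem6p1 :
  (exists cL : R, 0 < cL /\ Lang_conjecture cL) ->
  exists A C : R, [/\ 1 < A, 0 < C &
    forall E : wcoef, global_minimal E ->
    forall r : nat, rank_is E r ->
    forall (N : nat) (P : nat -> rat * rat),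
      (forall i, leq i.+1 N ->
         [/\ on_curve E (Some (P i)), sX E (P i) \is a Num.int
           & sY E (P i) \is a Num.int]) ->
      (exists a d : rat, d != 0 /\
         forall i, leq i.+1 N -> sX E (P i) = a + i%:R * d) ->
      (N%:R : R) <= C * A ^+ r].
Proof.
move=> [cL [cL0 lang]].
(* Adding 2 ensures [1 < M], so [M ^ 2] also exceeds [1173 / cL]. *)
pose M := (Num.bound (1173 / cL)).+2.
have hM : 1173 <= M%:R ^+ 2 * cL.
  have h : 1173 / cL < (Num.bound (1173 / cL))%:R.
    by apply: archi_boundP; apply: divr_ge0 (ltW cL0); rewrite ler0n.
  rewrite ltr_pdivrMr // in h; apply: le_trans (ltW h) _.
  apply: (ler_wpM2r (ltW cL0)); rewrite -natrX ler_nat expnS expn1.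
  by apply: leq_trans (leq_pmulr _ _); rewrite /M // ltnW.
(* Destructing the existential hides the value of [K], so that [K ^ 24] cannot be computed in unary
   [nat]. *)
have [K hK] : exists K, (4 * 14 <= K)%N by exists (4 * 14)%N.
have K0 : (0 < K)%N by exact: leq_trans hK.
exists (2 ^ ((2 * M + 3) * 24))%N%:R, (16 * K ^ 24)%N%:R; split.
- rewrite ltr1n; apply: (@leq_trans (2 ^ 1)%N); first exact: isT.
  by apply: leq_pexp2l; [exact: isT|rewrite muln_gt0 addn_gt0 orbT].
- by rewrite ltr0n muln_gt0 expn_gt0 K0.
move=> E minE r hr N P hP ap.
have := integral_progression_bound minE cL0 lang hr (isT : 1 < M)%N hM hK hP ap.
by rewrite expnAC -[((2 ^ _) ^ 24)%N]expnM -natrX -natrM ler_nat.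
Qed.
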